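(* If $q$ is even and fixed, then, for each choice of sign in $\mathrm{O}^{\pm}$, $\Omega^{\pm}$ (the same sign in both), $$\lim_{m\to\infty}\frac{i(\mathrm{O}^{\pm}(4m,q)\setminus\Omega^{\pm}(4m,q))}{q^{(2m)^2}}=\frac12\left(\prod_{i\ge 1}(1+1/q^{2i-1})-\prod_{i\ge 1}(1-1/q^{2i-1})\right),$$ and $$\lim_{m\to\infty}\frac{i(\mathrm{O}^{\pm}(4m+2,q)\setminus\Omega^{\pm}(4m+2,q))}{q^{(2m+1)^2}}=\frac12\left(\prod_{i\ge 1}(1+1/q^{2i-1})+\prod_{i\ge 1}(1-1/q^{2i-1})\right).$$
   Context: $q$ is a power of $2$. $\mathrm{O}^{+}(2n,q)$ is the isometry group of the quadratic form $x_1x_{1+n}+x_2x_{2+n}+\cdots+x_nx_{2n}$ on $\mathbb{F}_q^{2n}$, and $\mathrm{O}^{-}(2n,q)$ is the isometry group of a form in the other equivalence class of non-defective quadratic forms on $\mathbb{F}_q^{2n}$ (Witt index $n-1$). $\Omega^{\pm}(2n,q)$ is the derived subgroup of $\mathrm{O}^{\pm}(2n,q)$; for $n\ge 3$ it has index $2$ and consists of the $g\in\mathrm{O}^{\pm}(2n,q)$ with $\mathrm{rank}(1+g)$ even. $i(X)$ denotes the number of $g\in X$ with $g^2=1$. *)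

(* Defs.v *)
From HB Require Import structures.
From mathcomp Require Import all_boot all_order all_algebra all_fingroup.
From mathcomp Require Import all_solvable.
From mathcomp Require Import all_classical all_reals all_analysis.

Set Implicit Arguments.
Unset Strict Implicit.
Unset Printing Implicit Defensive.

Import Order.TTheory GRing.Theory Num.Theory.
Import numFieldNormedType.Exports.

Local Open Scope ring_scope.

Section QuadraticForms.
Variables (F : finFieldType) (d : nat).
Implicit Types Q : 'rV[F]_d -> F.

Definition polar Q (u v : 'rV[F]_d) : F := Q (u + v) - Q u - Q v.

Definition quadratic_form Q : Prop :=
  (forall (a : F) (v : 'rV[F]_d), Q (a *: v) = a ^+ 2 * Q v) /\
  bilinear_for *%R *%R (polar Q).

(* In even dimension over a finite field of characteristic 2, this is the same
   as asking that Q have no nonzero singular vector in the radical of its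
   polar form. *)
Definition non_defective Q : Prop :=
  forall u : 'rV[F]_d, (forall v, polar Q u v = 0) -> u = 0.

Definition equivalent_forms Q1 Q2 : Prop :=
  exists2 f : {linear 'rV[F]_d -> 'rV[F]_d},
    bijective f & forall v, Q2 (f v) = Q1 v.

(* A permutation group, rather than a subset of {'GL_d[F]}, because the latter
   consists of matrices of size d.-1.+1, which is not convertible to d. *)
Definition isometry_set Q : {set {perm 'rV[F]_d}} :=
  [set g : {perm 'rV[F]_d} |
     [forall a : F, forall u, forall v, g (a *: u + v) == a *: g u + g v]
     && [forall v, Q (g v) == Q v]].

Lemma isometry_setP Q (g : {perm 'rV[F]_d}) :
  reflect (linear g /\ forall v, Q (g v) = Q v) (g \in isometry_set Q).
Proof.
rewrite inE; apply: (iffP andP) => [[/forallP lg /forallP Qg]|[lg Qg]].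
  split=> [a u v|v]; last exact/eqP.
  by have /forallP/(_ u)/forallP/(_ v)/eqP := lg a.
split; last by apply/forallP => v; rewrite Qg.
by apply/forallP => a; apply/forallP => u; apply/forallP => v; rewrite lg.
Qed.

Lemma isometry_group_set Q : group_set (isometry_set Q).
Proof.
apply/group_setP; split=> [|g h /isometry_setP[lg Qg] /isometry_setP[lh Qh]].
  by apply/isometry_setP; split=> [a u v|v]; rewrite !perm1.
by apply/isometry_setP; split=> [a u v|v]; rewrite !permM ?lg ?lh // Qh Qg.
Qed.

Canonical isometry_group Q : {group {perm 'rV[F]_d}} :=
  Group (isometry_group_set Q).

Definition Omega Q : {set {perm 'rV[F]_d}} := ((isometry_group Q)^`(1))%g.

End QuadraticForms.

Definition hyperbolic_form (F : finFieldType) (n : nat)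
    (v : 'rV[F]_(n + n)) : F :=
  \sum_(i < n) v 0 (lshift n i) * v 0 (rshift n i).

Variant form_type := PlusType | MinusType.

Definition has_form_type (F : finFieldType) (n : nat) (s : form_type)
    (Q : 'rV[F]_(n + n) -> F) : Prop :=
  match s with
  | PlusType => Q = @hyperbolic_form F n
  | MinusType => [/\ quadratic_form Q, non_defective Q &
                     ~ equivalent_forms Q (@hyperbolic_form F n)]
  end.

(* The identity is counted. *)
Definition num_involutions (gT : finGroupType) (X : {set gT}) : nat :=
  #|[set g in X | (g ^+ 2 == 1)%g]|.

Definition infinite_prod (R : realType) (u : nat -> R) : R :=
  limn (fun N => \prod_(1 <= i < N.+1) u i).

(* Main.v *)
(* In characteristic 2 an involution is [1 + N] with [N ^ 2 = 0], and it lies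
   in O(Q) when moreover [Q (v N) = B (v, v N)]. Call it alternating when [Q]
   vanishes on the image of [N]; its rank is then even. Multiplying by the
   transvection along a nonsingular vector [w] fixed by the involution changes
   the rank by 1, up or down according to whether [w] lies in the image of [N].
   Hence every non-alternating involution of rank k is a product of k commuting
   transvections, while an alternating one loses rank 2 after multiplication by
   a Siegel transformation, itself a product of 4 transvections.

   Membership in Omega: products of two transvections are commutators, as
   transvections are conjugate, and the Dickson invariant is an additive
   character of O(Q) taking the value 1 on transvections. So an involution
   lies in Omega exactly when its rank is even.

   Counting: for a non-alternating involution, [Q] is equidistributed on the
   image and on the kernel of [N]; double counting the pairs of involutions
   that differ by a transvection gives a two-term recursion for the number c_k
   of non-alternating involutions of rank k. With x = 1 / q and t = x ^ 2 its
   solution is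
     c_k / q^(n^2) = u x^((n-k)^2) (t)_(n-1) / ((t)_(n-k) (t)_floor((k-1)/2)),
   where (t)_m is the product of the 1 - t^i for 1 <= i <= m and u is
   q^(1-2n) #{Q = 1}, so that u tends to 1. Up to a factor tending to 1,
   the quotient is a Gaussian binomial coefficient, and the sum over
   odd k is evaluated by the q-binomial theorem at x and at - x. *)
Require Import Defs.
From HB Require Import structures.
From mathcomp Require Import all_boot all_order all_algebra all_fingroup.
From mathcomp Require Import all_solvable.
From mathcomp Require Import all_classical all_reals all_analysis.
From mathcomp Require Import mxabelem.
From mathcomp Require Import ring lra zify.

Set Implicit Arguments.
Unset Strict Implicit.
Unset Printing Implicit Defensive.

Import Order.TTheory GRing.Theory Num.Theory.
Import numFieldNormedType.Exports.

Local Open Scope ring_scope.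

(** * Matrix factorization and characteristic 2 *)

Lemma eqmx_act (K : fieldType) (m n : nat) (M N : 'M[K]_(m, n)) :
  (forall x : 'rV_m, x *m M = x *m N) -> M = N.
Proof. by move=> eqMN; apply/row_matrixP => i; rewrite !rowE eqMN. Qed.

Lemma mulmx_factor (K : fieldType) (m n p : nat) (M : 'M[K]_(m, n))
    (C : 'M[K]_(m, p)) :
  (forall x : 'rV_m, x *m M = 0 -> x *m C = 0) -> exists D, C = M *m D.
Proof.
move=> kerMC; exists (pinvmx M *m C); apply: eqmx_act => x.
apply/eqP; rewrite -subr_eq0 -mulmxBr mulmxA -[X in X - _]mul1mx -mulmxBl mulmxA.
rewrite kerMC // -mulmxA mulmxBl mul1mx mulmxKpV ?submx_refl // subrr mulmx0 //.
Qed.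

Section Pchar2.
Variable F : finFieldType.
Hypothesis F2 : 2 \in [pchar F].

Lemma addmm_pchar2 m n (M : 'M[F]_(m, n)) : M + M = 0.
Proof. by apply/matrixP => i j; rewrite !mxE (addrr_pchar2 F2). Qed.

Lemma oppmx_pchar2 m n (M : 'M[F]_(m, n)) : - M = M.
Proof. by apply/matrixP => i j; rewrite !mxE (oppr_pchar2 F2). Qed.

Lemma addmK_pchar2 m n (M N : 'M[F]_(m, n)) : M + N + N = M.
Proof. by rewrite -addrA addmm_pchar2 addr0. Qed.

Lemma sqrrD_pchar2 (a b : F) : (a + b) ^+ 2 = a ^+ 2 + b ^+ 2.
Proof. by rewrite sqrrD mulr2n (addrr_pchar2 F2) addr0. Qed.

Lemma sqr_inj_pchar2 : injective (fun a : F => a ^+ 2).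
Proof.
move=> a b /= eqab; apply/eqP; rewrite -subr_eq0 (oppr_pchar2 F2) -sqrf_eq0.
by rewrite sqrrD_pchar2 eqab (addrr_pchar2 F2).
Qed.

(** Squaring is injective on a finite field, so its inverse function takes square roots. In
    particular they rescale any vector with [Q v != 0] to one with value 1. *)
Lemma sqrt_exists_pchar2 : {r : F -> F | forall a, r a ^+ 2 = a}.
Proof.
by exists (invF sqr_inj_pchar2) => a; have := f_invF sqr_inj_pchar2 a.
Qed.

End Pchar2.

(** * Involutions and transvections of a non-defective form *)

Section NonDefectiveForm.
Variables (F : finFieldType) (d : nat) (Q : 'rV[F]_d -> F).
Hypotheses (F2 : 2 \in [pchar F]) (Qquad : quadratic_form Q)
  (Qnd : non_defective Q).

Local Notation B := (polar Q).
Implicit Types (x y u v w : 'rV[F]_d) (N M : 'M[F]_d).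

Lemma quadZ a v : Q (a *: v) = a ^+ 2 * Q v. Proof. exact: Qquad.1. Qed.

Lemma quad0 : Q 0 = 0. Proof. by rewrite -(scale0r 0) quadZ expr0n mul0r. Qed.

Lemma quadD u v : Q (u + v) = Q u + Q v + B u v.
Proof. by rewrite /polar; ring. Qed.

Lemma polarC u v : B u v = B v u.
Proof. by rewrite /polar [u + v]addrC; ring. Qed.

Lemma polarDl u v w : B (u + v) w = B u w + B v w.
Proof. by have /= := (Qquad.2).1 w 1 u v; rewrite scale1r mul1r. Qed.

Lemma polarDr u v w : B u (v + w) = B u v + B u w.
Proof. by rewrite polarC polarDl !(polarC u). Qed.

Lemma polar0l v : B 0 v = 0.
Proof. by apply: (addrI (B 0 v)); rewrite -polarDl !addr0. Qed.

Lemma polar0r v : B v 0 = 0. Proof. by rewrite polarC polar0l. Qed.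

Lemma polarZl a u v : B (a *: u) v = a * B u v.
Proof. by have /= := (Qquad.2).1 v a u 0; rewrite !addr0 polar0l addr0. Qed.

Lemma polarZr a u v : B u (a *: v) = a * B u v.
Proof. by rewrite polarC polarZl polarC. Qed.

Lemma polarxx v : B v v = 0.
Proof.
by rewrite /polar (addmm_pchar2 F2) quad0 sub0r (oppr_pchar2 F2) (addrr_pchar2 F2).
Qed.

Definition polar_simp :=
  (polarDl, polarDr, polarZl, polarZr, polar0l, polar0r, polarxx).

Definition gram : 'M[F]_d := \matrix_(i, j) B (delta_mx 0 i) (delta_mx 0 j).

Lemma polarE u v : B u v = (u *m gram *m v^T) 0 0.
Proof.
pose C := fun x y => (x *m gram *m y^T) 0 0; rewrite -/(C u v).
have CDl x y w : C (x + y) w = C x w + C y w by rewrite /C !mulmxDl mxE.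
have CZl a x w : C (a *: x) w = a * C x w by rewrite /C -!scalemxAl mxE.
have CDr x y w : C w (x + y) = C w x + C w y.
  by rewrite /C linearD mulmxDr mxE.
have CZr a x w : C w (a *: x) = a * C w x.
  by rewrite /C linearZ -scalemxAr mxE.
have C0l w : C 0 w = 0 by rewrite /C !mul0mx mxE.
have C0r w : C w 0 = 0 by rewrite /C trmx0 mulmx0 mxE.
have sumL (G : 'rV[F]_d -> 'rV[F]_d -> F) :
    (forall x y w, G (x + y) w = G x w + G y w) ->
    (forall a x w, G (a *: x) w = a * G x w) -> (forall w, G 0 w = 0) ->
    forall x w, G x w = \sum_j x 0 j * G (delta_mx 0 j) w.
  move=> GD GZ G0 x w; rewrite {1}[x]row_sum_delta.
  by rewrite (big_morph (G ^~ w) (fun a b => GD a b w) (G0 w));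
    apply: eq_bigr => j _; rewrite GZ.
rewrite (sumL B polarDl polarZl polar0l) (sumL C CDl CZl C0l).
apply: eq_bigr => i _; congr (_ * _); rewrite polarC.
rewrite (sumL B polarDl polarZl polar0l).
rewrite (sumL (fun x y => C y x) CDr CZr C0r).
apply: eq_bigr => j _; congr (_ * _); rewrite polarC.
by rewrite /C -rowE trmx_delta -colE !mxE.
Qed.

Lemma polar_nondeg u : (forall v, B v u = 0) -> u = 0.
Proof. by move=> Bu; apply: Qnd => v; rewrite polarC. Qed.

Lemma polar_inj u v : (forall x, B x u = B x v) -> u = v.
Proof.
move=> Buv; apply/eqP; rewrite -subr_eq0; apply/eqP/polar_nondeg => x.
by rewrite oppmx_pchar2 // polarDr Buv (addrr_pchar2 F2).
Qed.

Lemma gram_unit : gram \in unitmx.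
Proof.
rewrite -row_free_unit -kermx_eq0; apply/eqP/row_matrixP => i; rewrite row0.
apply: polar_nondeg => v; rewrite polarC polarE.
have /sub_kermxP -> : (row i (kermx gram) <= kermx gram)%MS by exact: row_sub.
by rewrite mul0mx mxE.
Qed.

Lemma gram_sym : gram^T = gram.
Proof. by apply/matrixP => i j; rewrite !mxE polarC. Qed.

Lemma polar_repr (f : 'cV[F]_d) : exists v, forall x, B x v = (x *m f) 0 0.
Proof.
exists (invmx gram *m f)^T => x.
by rewrite polarE trmxK mulmxA mulmxK ?gram_unit.
Qed.

Lemma exists_polar1 u : u != 0 -> exists v, B v u = 1.
Proof.
move=> u0; have /existsP[v Bvu] : [exists v, B v u != 0].
  apply: contraR u0; rewrite negb_exists => /forallP Bu0.
  by apply/eqP/polar_nondeg => v; have /negPn/eqP := Bu0 v.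
by exists ((B v u)^-1 *: v); rewrite polarZl mulVf.
Qed.

(** For [Q w = 1], adding [1%:M] to [rank1_mx w w] gives the transvection along [w]. *)
Definition rank1_mx u w : 'M[F]_d := gram *m u^T *m w.

Lemma mul_rank1_mx x u w : x *m rank1_mx u w = B x u *: w.
Proof.
rewrite /rank1_mx !mulmxA [x *m gram *m _]mx11_scalar mul_scalar_mx.
by rewrite -polarE.
Qed.

(* The matrices [N] with [1 + N] an isometry of order at most 2. *)
Definition involution_mxs : {set 'M[F]_d} :=
  [set N | (N *m N == 0) && [forall v, Q (v *m N) == B v (v *m N)]].

Lemma involution_mxsP N :
  reflect (N *m N = 0 /\ forall v, Q (v *m N) = B v (v *m N))
          (N \in involution_mxs).
Proof.
rewrite inE; apply: (iffP andP) => [[/eqP NN /forallP QN]|[NN QN]].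
  by split=> // v; apply/eqP.
by split; [apply/eqP | apply/forallP => v; apply/eqP].
Qed.

Lemma involution_mxs0 : 0 \in involution_mxs.
Proof.
by apply/involution_mxsP; split=> [|v]; rewrite ?mul0mx // mulmx0 quad0 polar0r.
Qed.

Section OneInvolution.
Variable N : 'M[F]_d.
Hypothesis invN : N \in involution_mxs.

Lemma invol_mul0 x : x *m N *m N = 0.
Proof. by have /involution_mxsP[NN _] := invN; rewrite -mulmxA NN mulmx0. Qed.

Lemma invol_quad v : Q (v *m N) = B v (v *m N).
Proof. by have /involution_mxsP[_] := invN. Qed.

(** This polarizes the defining condition. Replacing [x] by [x *m N] then shows that the image is
    totally isotropic, after which the same identity makes [N] self-adjoint for [B]. *)
Lemma invol_polarD x y :
  B (x *m N) (y *m N) = B x (y *m N) + B y (x *m N).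
Proof.
have := invol_quad (x + y); rewrite mulmxDl quadD !polar_simp !invol_quad.
by move=> E; rewrite -[LHS](addKr (B x (x *m N) + B y (y *m N))) E; ring.
Qed.

Lemma invol_isotropic x y : B (x *m N) (y *m N) = 0.
Proof.
have := invol_polarD (x *m N) y.
by rewrite invol_mul0 polar0l polar0r addr0 => <-.
Qed.

Lemma invol_adj x y : B (x *m N) y = B x (y *m N).
Proof.
have /eqP := invol_polarD x y; rewrite invol_isotropic eq_sym addr_eq0.
by rewrite (oppr_pchar2 F2) => /eqP ->; rewrite polarC.
Qed.

Lemma invol_quadD x y : Q (x *m N + y *m N) = Q (x *m N) + Q (y *m N).
Proof. by rewrite quadD invol_isotropic addr0. Qed.

Lemma invol_ker_polar u w : u *m N = 0 -> (w <= N)%MS -> B u w = 0.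
Proof. by move=> uN /submxP[x ->]; rewrite -invol_adj uN polar0l. Qed.

Lemma invol_sub_ker w : (w <= N)%MS -> w *m N = 0.
Proof. by move=> /submxP[x ->]; rewrite invol_mul0. Qed.

Lemma invol_rank : (2 * \rank N <= d)%N.
Proof.
have /involution_mxsP[NN _] := invN.
by rewrite mul2n -addnn mulmx0_rank_max.
Qed.

(** With [invol_ker_polar], the image is exactly the orthogonal of the kernel. A functional [B _ w]
    that vanishes on the kernel factors through [N], and self-adjointness moves [N] to the other
    side, which exhibits [w] in the image. *)
Lemma invol_sub_im w :
  (forall x, x *m N = 0 -> B x w = 0) -> (w <= N)%MS.
Proof.
move=> kerN; have [D eD] : exists D, gram *m w^T = N *m D.
  apply: mulmx_factor => x /kerN; rewrite polarE -mulmxA.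
  by move=> e; apply/matrixP => i j; rewrite !ord1 e mxE.
have NJ : N *m gram = gram *m N^T.
  apply: eqmx_act => x; apply/rowP => j.
  have colA (A : 'rV[F]_d) : (A *m (delta_mx 0 j : 'rV_d)^T) 0 0 = A 0 j.
    by rewrite trmx_delta -colE mxE.
  have := invol_adj x (delta_mx 0 j).
  by rewrite !polarE trmx_mul !mulmxA !colA.
suff /(congr1 trmx) : w^T = N^T *m (invmx gram *m D).
  by rewrite trmxK !trmx_mul trmxK => ->; rewrite submxMl.
by apply: (can_inj (mulKmx gram_unit)); rewrite eD !mulmxA -NJ mulmxK ?gram_unit.
Qed.

Lemma invol_notin_im w :
  ~~ (w <= N)%MS -> exists2 x, x *m N = 0 & B x w = 1.
Proof.
move=> wN; have /existsP[x /andP[/eqP xN xw]] :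
    [exists x, (x *m N == 0) && (B x w != 0)].
  apply: contraR wN; rewrite negb_exists => /forallP H; apply: invol_sub_im => x xN.
  by have := H x; rewrite xN eqxx /= negbK => /eqP.
by exists ((B x w)^-1 *: x); rewrite ?polarZl ?mulVf // -scalemxAl xN scaler0.
Qed.

End OneInvolution.

Lemma rank_adds_row m (M : 'M[F]_(m, d)) w :
  ~~ (w <= M)%MS -> \rank (M + w)%MS = (\rank M).+1.
Proof.
move=> wM; apply/eqP; rewrite eqn_leq; apply/andP; split.
  rewrite (leq_trans (mxrank_adds_leqif M w)) // rank_rV.
  by case: (w != 0); rewrite ?addn1 ?addn0.
by apply: rank_ltmx; rewrite ltmxE addsmxSl addsmx_sub submx_refl.
Qed.

Section TransvectionStep.
Variables (N : 'M[F]_d) (w : 'rV[F]_d).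
Hypotheses (invN : N \in involution_mxs) (wN : w *m N = 0) (Qw : Q w = 1).
Local Notation N' := (N + rank1_mx w w).

Lemma step_act x : x *m N' = x *m N + B x w *: w.
Proof. by rewrite mulmxDr mul_rank1_mx. Qed.

Lemma step_quad x : Q (x *m N') = Q (x *m N) + B x w ^+ 2.
Proof.
by rewrite step_act quadD quadZ Qw mulr1 polarZr invol_adj // wN polar0r mulr0 addr0.
Qed.

Lemma step_invol : N' \in involution_mxs.
Proof.
apply/involution_mxsP; split=> [|x].
  apply: eqmx_act => x; rewrite mulmx0 mulmxA (step_act x) mulmxDl.
  rewrite -scalemxAl !step_act invol_mul0 // invol_adj // wN !polar_simp.
  by rewrite !(scale0r, addr0, scaler0).
by rewrite step_quad invol_quad // step_act polarDr polarZr.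
Qed.

Lemma step_ker : w *m N' = 0.
Proof. by rewrite step_act wN polarxx scale0r addr0. Qed.

Lemma stepK : N' + rank1_mx w w = N.
Proof. exact: addmK_pchar2. Qed.

(** A kernel vector [x] of [N] with [B x w = 1] is sent to [w] by [N'], so the image of [N'] is that
    of [N] plus the line of [w]. *)
Lemma step_up :
  ~~ (w <= N)%MS -> (w <= N')%MS /\ \rank N' = (\rank N).+1.
Proof.
move=> wN'; have [x xN xw] := invol_notin_im invN wN'.
have wsub : (w <= N')%MS.
  by apply/submxP; exists x; rewrite step_act xN xw scale1r add0r.
split=> //; rewrite -(rank_adds_row wN'); apply: eqmx_rank; apply/andP; split.
  by rewrite addmx_sub_adds // submxMl.
rewrite addsmx_sub wsub andbT -{1}stepK addmx_sub //.
by rewrite (submx_trans _ wsub) // submxMl.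
Qed.

End TransvectionStep.

(** If [w = v *m N], then [B v w = Q w = 1], so the new matrix kills [v]. Its image is orthogonal to
    its kernel, hence misses [w], and [step_up] applied to the new matrix gives the rank. *)
Lemma step_down N w : N \in involution_mxs -> (w <= N)%MS -> Q w = 1 ->
  ~~ (w <= (N + rank1_mx w w)%R)%MS /\ \rank N = (\rank (N + rank1_mx w w)%R).+1.
Proof.
move=> invN wsub Qw; have wN := invol_sub_ker invN wsub.
have invN' := step_invol invN wN Qw; have wN' := step_ker wN.
have wsub' : ~~ (w <= (N + rank1_mx w w)%R)%MS.
  have /submxP[v vN] := wsub.
  have Bvw : B v w = 1 by rewrite vN -invol_quad // -vN.
  have vN' : v *m (N + rank1_mx w w) = 0.
    by rewrite step_act -vN Bvw scale1r (addmm_pchar2 F2).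
  by apply/negP => /(invol_ker_polar invN' vN') /eqP; rewrite Bvw oner_eq0.
by split=> //; have [_] := step_up invN' wsub'; rewrite stepK.
Qed.

Definition alternating_mx N := [forall x, Q (x *m N) == 0].

Lemma alternating_mxP N :
  reflect (forall x, Q (x *m N) = 0) (alternating_mx N).
Proof.
by apply: (iffP forallP) => H x; [apply/eqP | rewrite H].
Qed.

Lemma alternating_mxPn N :
  reflect (exists2 w, (w <= N)%MS & Q w = 1) (~~ alternating_mx N).
Proof.
rewrite negb_forall; apply: (iffP existsP) => [[x Qx]|[w /submxP[x ->] Qw]].
  have [r rE] := sqrt_exists_pchar2 F2.
  exists (r (Q (x *m N))^-1 *: (x *m N)); last by rewrite quadZ rE mulVf.
  by rewrite scalemx_sub // submxMl.
by exists x; rewrite Qw oner_eq0.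
Qed.

(** For [a] and [b] singular and orthogonal, this is a Siegel transformation minus the identity. *)
Definition siegel_mx a b := rank1_mx a b + rank1_mx b a.

Lemma mul_siegel_mx x a b : x *m siegel_mx a b = B x a *: b + B x b *: a.
Proof. by rewrite mulmxDr !mul_rank1_mx. Qed.

(** Take [b = v2 *m N] nonzero, [v1] with [B v1 b = 1] and [a = v1 *m N]. Adding the Siegel matrix
    of [a] and [b] kills [v1] and [v2], and so removes [a] and [b] from the image. *)
Lemma alternating_step N : N \in involution_mxs -> alternating_mx N -> N != 0 ->
  exists N' a b, [/\ N' \in involution_mxs /\ alternating_mx N',
    \rank N = (\rank N').+2, [/\ Q a = 0, Q b = 0 & B a b = 0],
    N' *m siegel_mx a b = 0 & N = N' + siegel_mx a b].
Proof.
move=> invN /alternating_mxP altN N0.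
have [v2 v2N] : exists v, v *m N != 0.
  apply/existsP; apply: contraR N0; rewrite negb_exists => /forallP H.
  by apply/eqP/eqmx_act => x; rewrite mulmx0; have /negPn/eqP := H x.
have [v1 Bv12] := exists_polar1 v2N.
set b := v2 *m N in v2N Bv12; pose a := v1 *m N.
have Bv2a : B v2 a = 1 by rewrite -invol_adj // -/b polarC.
have Bv1a : B v1 a = 0 by rewrite -invol_quad // altN.
have Bv2b : B v2 b = 0 by rewrite -invol_quad // altN.
have Bab : B a b = 0 by rewrite invol_isotropic.
have Qa : Q a = 0 by exact: altN.
have Qb : Q b = 0 by exact: altN.
have aN : a *m N = 0 by rewrite invol_mul0.
have bN : b *m N = 0 by rewrite invol_mul0.
have BNa x : B (x *m N) a = 0 by rewrite invol_isotropic.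
have BNb x : B (x *m N) b = 0 by rewrite invol_isotropic.
pose N' := N + siegel_mx a b.
have actN' x : x *m N' = x *m N + (B x a *: b + B x b *: a).
  by rewrite mulmxDr mul_siegel_mx.
have quadN' x : Q (x *m N') = 0.
  rewrite actN' !quadD !quadZ altN Qa Qb !polar_simp BNa BNb (polarC b a) Bab; ring.
have invN' : N' \in involution_mxs.
  apply/involution_mxsP; split=> [|x].
    apply: eqmx_act => x; rewrite mulmx0 mulmxA (actN' x) !mulmxDl -!scalemxAl.
    rewrite !actN' invol_mul0 // aN bN !BNa !BNb ?(polarC b a) ?Bab ?polarxx.
    by rewrite !(scale0r, addr0, scaler0).
  rewrite quadN' actN' !polarDr -invol_quad // altN !polarZr add0r.
  by rewrite mulrC (addrr_pchar2 F2).
have v1N' : v1 *m N' = 0.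
  by rewrite actN' Bv1a Bv12 scale0r scale1r add0r (addmm_pchar2 F2).
have v2N' : v2 *m N' = 0.
  by rewrite actN' Bv2b Bv2a scale0r scale1r addr0 (addmm_pchar2 F2).
(* The image of [N'] is orthogonal to [v1] and [v2]. Since [v2] pairs to 1 with [a], while [v1]
   pairs to 0 with [a] and to 1 with [b], the two vectors are independent modulo that image. *)
have asub : ~~ (a <= N')%MS.
  by apply/negP => /(invol_ker_polar invN' v2N') /eqP; rewrite Bv2a oner_eq0.
have bsub : ~~ (b <= N' + a)%MS.
  apply/negP => /sub_addsmxP[[y c] /= bE].
  have /eqP := Bv12; rewrite bE polarDr (invol_ker_polar invN' v1N') ?submxMl //.
  by rewrite [c]mx11_scalar mul_scalar_mx polarZr Bv1a mulr0 addr0 eq_sym oner_eq0.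
have NE : N = N' + siegel_mx a b by rewrite (addmK_pchar2 F2).
exists N', a, b; split=> //.
- by split=> //; apply/alternating_mxP.
- rewrite -(rank_adds_row asub) -(rank_adds_row bsub); apply: eqmx_rank.
  have aN'b : (siegel_mx a b <= a + b)%MS.
    by rewrite addsmxC addmx_sub_adds // submxMl.
  apply/andP; split.
    by rewrite {1}NE -addsmxA addmx_sub_adds.
  rewrite !addsmx_sub !submxMl !andbT addmx_sub //.
  by rewrite (submx_trans aN'b) // addsmx_sub !submxMl.
apply: eqmx_act => x; rewrite mulmx0 mulmxA mul_siegel_mx actN' !polar_simp.
by rewrite BNa BNb (polarC b a) Bab !(mulr0, addr0, scale0r).
Qed.

(** A nonzero alternating matrix loses a Siegel summand, any other one a transvection along a
    nonsingular vector of its image. The rank drops each time, by 2 or by 1, whence the induction on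
    a bound for the rank. *)
Lemma involution_mxs_ind (P : 'M[F]_d -> Prop) : P 0 ->
  (forall N a b, [/\ N \in involution_mxs, alternating_mx N & P N] ->
     [/\ Q a = 0, Q b = 0 & B a b = 0] -> N *m siegel_mx a b = 0 ->
     N + siegel_mx a b \in involution_mxs ->
     alternating_mx (N + siegel_mx a b) ->
     \rank (N + siegel_mx a b)%R = (\rank N).+2 -> P (N + siegel_mx a b)) ->
  (forall N w, [/\ N \in involution_mxs & P N] -> w *m N = 0 -> Q w = 1 ->
     N + rank1_mx w w \in involution_mxs -> (w <= (N + rank1_mx w w)%R)%MS ->
     \rank (N + rank1_mx w w)%R = (\rank N).+1 -> P (N + rank1_mx w w)) ->
  forall N, N \in involution_mxs -> P N.
Proof.
move=> P0 Palt Pstep N; move: {2}(\rank N) (leqnn (\rank N)) => k.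
elim: k N => [|k IHk] N.
  by rewrite leqn0 mxrank_eq0 => /eqP ->.
move=> rkN invN; have [->//|N0] := eqVneq N 0.
have [altN|/alternating_mxPn[w wsub Qw]] := boolP (alternating_mx N).
  have [N' [a [b [[invN' altN'] rkE Qab N'S NE]]]] := alternating_step invN altN N0.
  rewrite NE; apply: Palt; rewrite -?NE //; split=> //; apply: IHk => //.
  by move: rkN; rewrite rkE ltnS => /ltnW.
have wN := invol_sub_ker invN wsub.
have [wsub' rkE] := step_down invN wsub Qw.
have NE := stepK N w.
rewrite -NE; apply: Pstep; rewrite ?NE //; last exact: step_ker.
by split; [exact: step_invol | apply: IHk (step_invol invN wN Qw); rewrite -ltnS -rkE].
Qed.

Lemma alternating_rank_even N :
  N \in involution_mxs -> alternating_mx N -> ~~ odd (\rank N).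
Proof.
move=> invN; move: {2}(\rank N) (leqnn (\rank N)) => k.
elim: k N invN => [|k IHk] N invN rkN altN.
  by move: rkN; rewrite leqn0 => /eqP ->.
have [->|N0] := eqVneq N 0; first by rewrite mxrank0.
have [N' [a [b [[invN' altN'] rkE _ _ _]]]] := alternating_step invN altN N0.
rewrite rkE /= negbK; apply: IHk => //.
by move: rkN; rewrite rkE ltnS => /ltnW.
Qed.

(** The map sending [x] to [Q (x *m N)] is additive, because the image is isotropic, and scales by
    squares. Its pointwise square root is thus a linear form, represented by a vector [s]. This
    vector decides which transvection makes [N] alternating. *)
Lemma invol_sqrt N : N \in involution_mxs ->
  exists s, forall x, B x s ^+ 2 = Q (x *m N).
Proof.
move=> invN; have [r rE] := sqrt_exists_pchar2 F2.
have [s sE] := polar_repr (\col_i r (Q (delta_mx 0 i *m N))).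
exists s => x; rewrite sE mxE.
rewrite (big_morph (fun a : F => a ^+ 2) (sqrrD_pchar2 F2) (expr0n F 2)).
have QD y z : Q ((y + z) *m N) = Q (y *m N) + Q (z *m N).
  by rewrite mulmxDl invol_quadD.
have Q0 : Q (0 *m N) = 0 by rewrite mul0mx quad0.
rewrite {2}[x]row_sum_delta (big_morph (fun y => Q (y *m N)) QD Q0).
by apply: eq_bigr => i _; rewrite mxE exprMn rE -scalemxAl quadZ.
Qed.

Section SquareRoot.
Variables (N : 'M[F]_d) (s : 'rV[F]_d).
Hypotheses (invN : N \in involution_mxs) (sE : forall x, B x s ^+ 2 = Q (x *m N)).

Lemma invol_sqrt_sub : (s <= N)%MS.
Proof.
by apply: invol_sub_im => // x xN; apply/eqP; rewrite -sqrf_eq0 sE xN quad0.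
Qed.

(** By [step_quad] the new value at [x] is [B x s ^+ 2 + B x w ^+ 2], the square of
    [B x (s + w)]. *)
Lemma alternating_stepE w : w *m N = 0 -> Q w = 1 ->
  alternating_mx (N + rank1_mx w w) = (w == s).
Proof.
move=> wN Qw; apply/alternating_mxP/eqP => [altN|ws x]; last first.
  by rewrite step_quad // ws sE (addrr_pchar2 F2).
apply: polar_inj => x; apply: (sqr_inj_pchar2 F2) => /=; rewrite sE.
have /eqP := altN x; rewrite step_quad // addr_eq0 (oppr_pchar2 F2).
by move/eqP->.
Qed.

End SquareRoot.

(** Induction on the construction of [N]. An alternating matrix has [s = 0] and even rank. A
    transvection step replaces [s] by [s + w] with [B s w = 0], which changes both [Q s] and the
    rank by 1. *)
Lemma invol_sqrt_quad N s : N \in involution_mxs ->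
  (forall x, B x s ^+ 2 = Q (x *m N)) -> Q s = (odd (\rank N))%:R.
Proof.
have alts0 M t : alternating_mx M -> (forall x, B x t ^+ 2 = Q (x *m M)) -> t = 0.
  move=> /alternating_mxP altM tE; apply: polar_nondeg => x; apply/eqP.
  by rewrite -sqrf_eq0 tE altM.
move=> invN; move: N invN s; apply: involution_mxs_ind => [s sE|N a b _ _ _ invN altN _ s sE|].
- by rewrite (alts0 0 s) // ?quad0 ?mxrank0 //; apply/alternating_mxP => x;
    rewrite mulmx0 quad0.
- by rewrite (alts0 _ _ altN sE) quad0 (negPf (alternating_rank_even invN altN)).
move=> N w [invN IH] wN Qw invN' wsub rkE s sE.
have sw x : B x (s + w) ^+ 2 = Q (x *m N).
  by rewrite polarDr (sqrrD_pchar2 F2) sE step_quad // -addrA (addrr_pchar2 F2) addr0.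
have Bsw : B s w = 0.
  apply: (invol_ker_polar invN') => //.
  by apply: (invol_sub_ker invN'); apply: invol_sqrt_sub sE.
have := IH _ sw; rewrite quadD Bsw addr0 Qw rkE /= => Qs.
rewrite -[Q s]addr0 -(addrr_pchar2 F2 1) addrA Qs.
by case: odd; rewrite /= ?add0r ?(addrr_pchar2 F2).
Qed.

(** * Recursion for the number of non-alternating involutions of given rank *)

Lemma card_row_sub m (U : 'M[F]_(m, d)) :
  #|[set w : 'rV[F]_d | (w <= U)%MS]| = (#|F| ^ \rank U)%N.
Proof. by rewrite -card_rowg; apply: eq_card => w; rewrite mem_rowg. Qed.

(** Translations by multiples of [w] stay in [U] and, [w] being orthogonal to [U], shift [Q] by
    arbitrary constants. So all fibers of [Q] on [U] have the same size. *)
Lemma card_quad1 m (U : 'M[F]_(m, d)) w : (w <= U)%MS -> Q w = 1 ->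
  (forall u, (u <= U)%MS -> B u w = 0) ->
  (#|[set u : 'rV[F]_d | (u <= U)%MS & (Q u == 1)%R]| * #|F| = #|F| ^ \rank U)%N.
Proof.
move=> wU Qw BUw; have [r rE] := sqrt_exists_pchar2 F2.
pose fib a := [set u : 'rV[F]_d | (u <= U)%MS & Q u == a].
have fibE a : #|fib a| = #|fib 1|.
  have tr v : (v <= U)%MS -> Q (v + r (a + 1) *: w) = Q v + (a + 1).
    by move=> vU; rewrite quadD quadZ rE Qw mulr1 polarZr BUw // mulr0 addr0.
  have -> : fib a = [set u + r (a + 1) *: w | u in fib 1].
    apply/setP => u; apply/idP/imsetP => [|[v]]; rewrite !inE.
      move=> /andP[uU /eqP Qu]; exists (u + r (a + 1) *: w).
        rewrite inE tr // Qu addrA (addrr_pchar2 F2) add0r eqxx andbT.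
        by rewrite addmx_sub // scalemx_sub.
      by rewrite (addmK_pchar2 F2).
    move=> /andP[vU /eqP Qv] ->; rewrite tr // Qv addrCA (addrr_pchar2 F2) addr0 eqxx.
    by rewrite addmx_sub // scalemx_sub.
  by rewrite card_imset //; apply: addIr.
rewrite -card_row_sub -[RHS]sum1_card (partition_big Q xpredT) //=.
rewrite mulnC -sum_nat_const; apply: eq_bigr => a _; rewrite -(fibE a) -sum1_card.
by apply: eq_bigl => u; rewrite !inE.
Qed.

(** For an involution matrix [N], the vectors whose transvection lowers the rank; those in [up_set]
    raise it. *)
Definition down_set N := [set w : 'rV[F]_d | (w <= N)%MS & Q w == 1].
Definition up_set N := [set w : 'rV[F]_d | [&& w *m N == 0, ~~ (w <= N)%MS & Q w == 1]].

Lemma card_down_set N : N \in involution_mxs -> ~~ alternating_mx N ->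
  #|down_set N| = (#|F| ^ (\rank N).-1)%N.
Proof.
move=> invN /alternating_mxPn[w wN Qw].
have F0 : (0 < #|F|)%N by apply/card_gt0P; exists 0.
have rk0 : (0 < \rank N)%N.
  rewrite lt0n mxrank_eq0; apply/eqP => N0; move: wN Qw; rewrite N0 submx0 => /eqP ->.
  by rewrite quad0 => /eqP; rewrite eq_sym oner_eq0.
apply/eqP; rewrite -(eqn_pmul2r F0) (card_quad1 wN Qw) => [|u uN].
  by rewrite -expnSr prednK.
by apply: (invol_ker_polar invN) => //; apply: (invol_sub_ker invN).
Qed.

Lemma card_up_set N : N \in involution_mxs -> ~~ alternating_mx N ->
  #|up_set N| = (#|F| ^ (d - \rank N).-1 - #|F| ^ (\rank N).-1)%N.
Proof.
move=> invN altN; rewrite -(card_down_set invN altN).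
have /alternating_mxPn[w wN Qw] := altN.
have F0 : (0 < #|F|)%N by apply/card_gt0P; exists 0.
(* The kernel is nonzero, so the predecessor in the exponent is not truncated. *)
have rkd : (0 < d - \rank N)%N.
  rewrite subn_gt0; have := invol_rank invN; have := rank_leq_col N.
  rewrite leq_eqVlt => /orP[/eqP rkd|//]; rewrite rkd mul2n -addnn -{3}[d]addn0 leq_add2l.
  rewrite leqn0 => /eqP d0; have := wN; rewrite -rkd in d0; move: d0 => /eqP.
  rewrite mxrank_eq0 => /eqP -> /submx0null w0.
  by have := Qw; rewrite w0 quad0 => /eqP; rewrite eq_sym oner_eq0.
have kerE u : (u <= kermx N)%MS = (u *m N == 0) by apply/sub_kermxP/eqP.
pose K := [set u : 'rV[F]_d | (u <= kermx N)%MS & Q u == 1].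
have : (#|K| = #|F| ^ (d - \rank N).-1)%N.
  apply/eqP; rewrite -(eqn_pmul2r F0) (@card_quad1 _ _ w) //.
  - by rewrite mxrank_ker -expnSr prednK.
  - by rewrite kerE (invol_sub_ker invN).
  by move=> u; rewrite kerE => /eqP uN; apply: (invol_ker_polar invN).
move=> <-; have subK : down_set N \subset K.
  apply/fintype.subsetP => u; rewrite !inE kerE => /andP[uN ->].
  by rewrite (invol_sub_ker invN uN) eqxx.
have <- : K :\: down_set N = up_set N.
  apply/setP => u; rewrite !inE kerE.
  by case: (u *m N == 0) => //=; case: (_ <= _)%MS => //=; case: (Q u == 1).
by rewrite cardsD (finset.setIidPr subK).
Qed.

(** Double counting: adding [rank1_mx w w] to [N] and keeping [w] is an involution on pairs. It
    exchanges the rank-lowering pairs at rank [k.+1] with the rank-raising pairs at rank [k]. *)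
Lemma card_step_pairs k (P : pred 'M[F]_d) :
  (\sum_(N in involution_mxs | \rank N == k.+1)
      #|[set w in down_set N | P (N + rank1_mx w w)%R]| =
   \sum_(N in involution_mxs | (\rank N == k) && P N) #|up_set N|)%N.
Proof.
pose phi (p : 'M[F]_d * 'rV[F]_d) := (p.1 + rank1_mx p.2 p.2, p.2).
have phiK : involutive phi by case=> N w; rewrite /phi /= addmK_pchar2.
under eq_bigr do rewrite -sum1_card.
under [RHS]eq_bigr do rewrite -sum1_card.
rewrite !pair_big_dep /= (reindex_inj (inv_inj phiK)) /=.
apply: eq_bigl => -[N w]; rewrite /phi /=.
have -> : (w \in [set u in down_set (N + rank1_mx w w) | P (N + rank1_mx w w + rank1_mx u u)])
    = [&& (w <= (N + rank1_mx w w)%R)%MS, Q w == 1 & P N].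
  by rewrite !inE stepK andbA.
have -> : (w \in up_set N) = [&& w *m N == 0, ~~ (w <= N)%MS & Q w == 1] by rewrite inE.
apply/idP/idP.
  move=> /andP[/andP[invN' /eqP rkE] /and3P[wsub /eqP Qw PN]].
  have wN' := invol_sub_ker invN' wsub.
  have [wsub' rkE'] := step_down invN' wsub Qw.
  have := step_invol invN' wN' Qw; have := step_ker wN'.
  move: rkE' wsub'; rewrite !stepK => rkE' -> -> ->.
  by move: rkE'; rewrite rkE Qw PN => -[<-]; rewrite !eqxx.
move=> /andP[/andP[invN /andP[/eqP rkE PN]] /and3P[/eqP wN wsub /eqP Qw]].
have [wsub' rkE'] := step_up invN wsub.
by rewrite (step_invol invN wN Qw) wsub' rkE' rkE Qw PN !eqxx.
Qed.

Definition nonalternating_rank k :=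
  [set N in involution_mxs | (\rank N == k) && ~~ alternating_mx N].

(** Initial value of the recursion. A matrix of rank 1 has exactly one vector in its [down_set], and
    the only matrix of rank 0 is 0, whose [up_set] consists of all vectors of value 1. *)
Lemma nonalternating_rank1 :
  #|nonalternating_rank 1| = #|[set w : 'rV[F]_d | Q w == 1]|.
Proof.
have := card_step_pairs 0 xpredT.
have alt1 N : N \in involution_mxs -> \rank N = 1%N -> ~~ alternating_mx N.
  by move=> invN rk1; apply/negP => /(alternating_rank_even invN); rewrite rk1.
rewrite [LHS](eq_bigr (fun=> 1%N)) => [|N /andP[invN /eqP rk1]]; last first.
  transitivity #|down_set N|; last by rewrite card_down_set ?alt1 // rk1.
  by apply: eq_card => w; rewrite [LHS]inE andbT.
rewrite sum1_card [X in X = _ -> _](_ : _ = #|nonalternating_rank 1|); last first.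
  apply: eq_card => N; rewrite [RHS]inE.
  apply/andP/and3P => [[invN rk1]|[invN rk1 _]]; split=> //.
  by apply: alt1 => //; apply/eqP.
move=> ->; rewrite (big_pred1 0) => [|N]; last first.
  rewrite andbT mxrank_eq0 /=; apply: andb_idl => /eqP ->; exact: involution_mxs0.
apply: eq_card => w; rewrite !inE mulmx0 eqxx submx0 /=; apply: andb_idl => /eqP Qw.
by apply/eqP => w0; move: Qw; rewrite w0 quad0 => /eqP; rewrite eq_sym oner_eq0.
Qed.

(** Count the pairs whose two members are both non-alternating. From rank [k.+1], the only downward
    step that reaches an alternating matrix is along [s], and [s] has value 1 exactly when [k.+1] is
    odd. This is the correction [~~ odd k]. *)
Lemma nonalternating_rankS k : (0 < k)%N ->
  (#|nonalternating_rank k.+1| * (#|F| ^ k - ~~ odd k) =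
   #|nonalternating_rank k| * (#|F| ^ (d - k).-1 - #|F| ^ k.-1))%N.
Proof.
move=> k0; have := card_step_pairs k (fun N => ~~ alternating_mx N).
rewrite [RHS](eq_bigr (fun=> (#|F| ^ (d - k).-1 - #|F| ^ k.-1)%N)); last first.
  by move=> N /andP[invN /andP[/eqP <- altN]]; apply: card_up_set.
rewrite sum_nat_const [X in _ = (X * _)%N -> _](_ : _ = #|nonalternating_rank k|); last first.
  by apply: eq_card => N; rewrite [RHS]inE.
move=> <-; rewrite (bigID (fun N => ~~ alternating_mx N)) /=.
rewrite [X in (_ + X)%N]big1 ?addn0; last first.
  move=> N /andP[_ /negPn/alternating_mxP altN].
  apply/eqP; rewrite cards_eq0; apply/eqP/setP => w; rewrite !inE.
  by case: submxP => //= -[x ->]; rewrite altN eq_sym oner_eq0.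
rewrite -sum_nat_const; apply: eq_big => [N|N].
  by rewrite [LHS]inE andbA.
rewrite [N \in _]inE => /andP[invN /andP[/eqP rkE altN]].
have [s sE] := invol_sqrt invN.
have -> : (#|F| ^ k)%N = #|down_set N| by rewrite card_down_set // rkE.
have <- : (s \in down_set N) = ~~ odd k.
  rewrite inE (invol_sqrt_sub invN sE) (invol_sqrt_quad invN sE) rkE /=.
  by case: odd; rewrite ?eqxx // eq_sym oner_eq0.
rewrite (cardsD1 s (down_set N)) addKn; apply: eq_card => w.
rewrite !inE; case wsub: (w <= N)%MS; rewrite ?andbF //=.
have [Qw|_] := eqVneq (Q w) 1; rewrite ?andbF //=.
by rewrite (alternating_stepE invN sE) ?andbT // (invol_sub_ker invN).
Qed.

(** * Singular cosets and the number of vectors of given value *)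

Lemma singular_coset_rank m (U : 'M[F]_(m, d)) v :
  (forall u, (u <= U)%MS -> Q (v + u) = 0) -> (2 * \rank U <= d)%N.
Proof.
move=> QvU; have BU x y : (x <= U)%MS -> (y <= U)%MS -> B x y = 0.
  move=> xU yU.
  (* The second difference of [Q] on the coset is the polar form, so [U] is totally isotropic. *)
  have -> : B x y = Q (v + (x + y)) - Q (v + x) - Q (v + y) + Q (v + 0).
    by rewrite !quadD !polarDr polar0r quad0; ring.
  by rewrite !QvU ?addmx_sub ?sub0mx // !subr0 addr0.
rewrite mul2n -addnn -{1}(mxrankMfree U (_ : row_free gram)) ?row_free_unit ?gram_unit //.
rewrite -(mxrank_tr U); apply: mulmx0_rank_max.
apply/row_matrixP => i; rewrite row0; apply/rowP => j.
have := BU _ _ (row_sub i U) (row_sub j U).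
rewrite polarE tr_row !row_mul => e; rewrite [RHS]mxE -[RHS]e !mxE.
by apply: eq_bigr => k _; rewrite !mxE.
Qed.

Lemma card_polar_eq u a : u != 0 ->
  (#|[set v | B v u == a]| * #|F| = #|F| ^ d)%N.
Proof.
move=> /exists_polar1[w wu].
have fibE c : #|[set v | B v u == c]| = #|[set v | B v u == a]|.
  have -> : [set v | B v u == c] = [set v + (c - a) *: w | v in [set v | B v u == a]].
    apply/setP => v; apply/idP/imsetP => [|[x]]; rewrite !inE.
      move=> /eqP vu; exists (v - (c - a) *: w); last by rewrite subrK.
      rewrite inE oppmx_pchar2 // polarDl polarZl wu vu mulr1 -(oppr_pchar2 F2 (c - a)).
      by rewrite opprB addrC subrK.
    by move=> /eqP xu ->; rewrite polarDl polarZl wu xu mulr1 addrC subrK.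
  by rewrite card_imset //; apply: addIr.
have <- : #|'rV[F]_d| = (#|F| ^ d)%N by rewrite card_mx mul1n.
rewrite -[RHS]sum1_card (partition_big (B ^~ u) xpredT) //=.
rewrite mulnC -sum_nat_const; apply: eq_bigr => c _; rewrite -(fibE c) -sum1_card.
by apply: eq_bigl => v; rewrite !inE.
Qed.

Definition quad_fiber a := [set v : 'rV[F]_d | Q v == a].

Lemma card_quad_fiber a : a != 0 -> #|quad_fiber a| = #|quad_fiber 1|.
Proof.
move=> a0; have [r rE] := sqrt_exists_pchar2 F2.
have ra0 : r a != 0 by rewrite -sqrf_eq0 rE.
rewrite -[RHS](card_imset _ (scalerI ra0)); apply: eq_card => v.
apply/idP/imsetP => [|[u]]; rewrite !inE => /eqP Qv.
  exists ((r a)^-1 *: v); rewrite ?scalerA ?mulfV ?scale1r //.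
  by rewrite inE quadZ Qv exprVn rE mulVf.
by move=> ->; rewrite quadZ rE Qv mulr1.
Qed.

(* Counting the pairs [(v, v + u)] with [Q v = Q (v + u)] according to [u]. *)
Lemma quad_fiber_square_sum : (0 < d)%N ->
  (\sum_a #|quad_fiber a| ^ 2 =
   #|F| ^ d + (#|F| ^ d).-1 * #|F| ^ d.-1)%N.
Proof.
move=> d0; have F0 : (0 < #|F|)%N by apply/card_gt0P; exists 0.
have cV : #|'rV[F]_d| = (#|F| ^ d)%N by rewrite card_mx mul1n.
transitivity (\sum_(u : 'rV[F]_d) #|[set v | B v u == Q u]|)%N; last first.
  rewrite (bigD1 0) //=; congr (_ + _)%N.
    by rewrite -cV; apply: eq_card => v; rewrite inE polar0r quad0 eqxx.
  rewrite (eq_bigr (fun=> (#|F| ^ d.-1)%N)) => [|u u0]; last first.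
    by apply/eqP; rewrite -(eqn_pmul2r F0) card_polar_eq // -expnSr prednK.
  by rewrite sum_nat_const cardC1 cV.
under eq_bigr => a _.
  have -> : (#|quad_fiber a| ^ 2 =
    \sum_(p : 'rV[F]_d * 'rV[F]_d | (Q p.1 == a) && (Q p.2 == a)) 1)%N.
    rewrite -mulnn -[X in (X * _)%N]sum1_card big_distrl /=.
    under eq_bigr do rewrite mul1n -sum1_card.
    by rewrite pair_big_dep /=; apply: eq_bigl => p; rewrite !inE.
  over.
rewrite (exchange_big_dep predT) //=.
under eq_bigr => p _.
  rewrite sum1_card.
  have -> : #|[pred a | (Q p.1 == a) && (Q p.2 == a)]| = (Q p.1 == Q p.2).
    case: eqP => [->|neq].
      transitivity #|pred1 (Q p.2)|; last by rewrite card1.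
      by apply: eq_card => a; rewrite !inE andbb eq_sym.
    apply: eq_card0 => a; rewrite !inE; apply/andP => -[/eqP e1 /eqP e2].
    by apply: neq; rewrite e1 e2.
  over.
pose h (p : 'rV[F]_d * 'rV[F]_d) := (p.1 + p.2, p.2).
have hK : involutive h by case=> u v; rewrite /h /= (addmK_pchar2 F2).
rewrite (reindex_inj (inv_inj hK)) /= -(pair_bigA _ (fun u v => (Q (u + v) == Q v : nat))) /=.
apply: eq_bigr => u _; rewrite -sum1_card big_mkcond [RHS]big_mkcond /=.
apply: eq_bigr => v _; rewrite inE quadD polarC.
have -> : (Q u + Q v + B v u == Q v) = (B v u == Q u).
  rewrite addrAC -subr_eq0 addrK addrC -(oppr_pchar2 F2 (Q u)) subr_eq0 (oppr_pchar2 F2).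
  by [].
by case: eqP.
Qed.

(** For [d = 2n] this reads [#{Q = 1} = q^(2n-1) ± q^(n-1)]. All nonzero values have fibers of the
    same size, so the sum of the sizes and the sum of their squares give two equations in two
    unknowns. Squaring the deviation treats both signs at once. *)
Lemma card_quad_fiber1 : (0 < d)%N ->
  ((#|quad_fiber 1%R|%:Z - (#|F| ^ d.-1)%:Z) ^+ 2 * #|F|%:Z = (#|F| ^ d.-1)%:Z)%R.
Proof.
move=> d0; have := quad_fiber_square_sum d0.
have F1 : (1 < #|F|)%N by exact: card_finNzRing_gt1.
have cV : #|'rV[F]_d| = (#|F| ^ d)%N by rewrite card_mx mul1n.
have sumE (f : nat -> nat) : (\sum_a f #|quad_fiber a| =
    f #|quad_fiber 0%R| + (#|F|.-1) * f #|quad_fiber 1%R|)%N.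
  rewrite (bigD1 0) //=; congr addn.
  under eq_bigr => a a0 do rewrite card_quad_fiber //.
  by rewrite sum_nat_const cardC1.
rewrite (sumE (fun k => k ^ 2)%N).
have : (\sum_a #|quad_fiber a| = #|F| ^ d)%N.
  rewrite -cV -[RHS]sum1_card (partition_big Q xpredT) //=.
  by apply: eq_bigr => a _; rewrite -sum1_card; apply: eq_bigl => v; rewrite !inE.
rewrite (sumE id).
have -> : (#|F| ^ d = #|F| * #|F| ^ d.-1)%N by rewrite -expnS prednK.
have : (0 < #|F| ^ d.-1)%N by rewrite expn_gt0 ltnW.
move: (#|quad_fiber 0%R|) (#|quad_fiber 1%R|) (#|F| ^ d.-1)%N F1 => z n D.
case: #|F| => [//|q']; rewrite ltnS => q0 D0 /= sum1 sum2.
have E1 : z%:Z = q'.+1%:Z * D%:Z - q'%:Z * n%:Z.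
  by rewrite -!PoszM -sum1 PoszD addrK.
have E2 : z%:Z ^+ 2 + q'%:Z * n%:Z ^+ 2 =
    q'.+1%:Z * D%:Z + (q'.+1%:Z * D%:Z - 1) * D%:Z.
  have qD0 : (0 < q'.+1 * D)%N by rewrite muln_gt0.
  have := congr1 Posz sum2; rewrite -!mulnn !PoszD !PoszM.
  rewrite -subn1 -subzn // PoszM => <-; ring.
have q0' : q'%:Z != 0 by rewrite -lt0n.
apply: (mulfI q0'); move: E2; rewrite E1 -[q'.+1]addn1 PoszD => E2.
apply/eqP; rewrite -subr_eq0; apply/eqP; move/eqP: E2.
by rewrite -subr_eq0 => /eqP <-; ring.
Qed.

(** * Involutions in the derived subgroup *)

(** A singular [G] yields the identity permutation by default. *)
Definition mx_perm (G : 'M[F]_d) : {perm 'rV[F]_d} :=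
  insubd (1%g : {perm 'rV[F]_d}) [ffun v : 'rV[F]_d => v *m G].

Lemma mx_permE G v : G \in unitmx -> mx_perm G v = v *m G.
Proof.
move=> uG; rewrite -pvalE /mx_perm.
have inj : injectiveb [ffun v : 'rV[F]_d => v *m G].
  by apply/injectiveP => x y; rewrite !ffunE; apply: (can_inj (mulmxK uG)).
have := val_insubd (1%g : {perm 'rV[F]_d}) [ffun v : 'rV[F]_d => v *m G].
by rewrite inj => /= ->; rewrite ffunE.
Qed.

Lemma add1_involution_unit N : N \in involution_mxs -> 1%:M + N \in unitmx.
Proof.
move=> /involution_mxsP[NN _]; apply: (@mulmx1_unit _ _ _ (1%:M + N) _).1.
by rewrite mulmxDl !mulmxDr !mul1mx mulmx1 NN addr0 (addmK_pchar2 F2).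
Qed.

Definition involution_perm N := mx_perm (1%:M + N).

Lemma involution_permE N v : N \in involution_mxs ->
  involution_perm N v = v + v *m N.
Proof. by move=> /add1_involution_unit u; rewrite mx_permE // mulmxDr mulmx1. Qed.

Lemma involution_perm0 : involution_perm 0 = 1%g.
Proof.
by apply/permP => v; rewrite involution_permE ?involution_mxs0 // mulmx0 addr0 perm1.
Qed.

Lemma involution_perm_isometry N : N \in involution_mxs ->
  involution_perm N \in isometry_group Q.
Proof.
move=> invN; apply/isometry_setP; split=> [a u v|v].
  by rewrite !mx_permE ?add1_involution_unit // mulmxDl scalemxAl.
by rewrite involution_permE // quadD invol_quad // -addrA (addrr_pchar2 F2) addr0.
Qed.

Lemma involution_perm_square N : N \in involution_mxs -> (involution_perm N ^+ 2 = 1)%g.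
Proof.
move=> invN; apply/permP => v; rewrite expgS expg1 permM perm1 !involution_permE //.
by rewrite mulmxDl invol_mul0 // addr0 (addmK_pchar2 F2).
Qed.

Lemma involution_perm_inj : {in involution_mxs &, injective involution_perm}.
Proof.
move=> N M invN invM eqNM; apply: eqmx_act => x; apply: (addrI x).
by rewrite -!involution_permE // eqNM.
Qed.

Lemma rank1_involution w : Q w = 1 -> rank1_mx w w \in involution_mxs.
Proof.
move=> Qw; rewrite -[rank1_mx w w]add0r; apply: step_invol Qw.
  exact: involution_mxs0.
exact: mulmx0.
Qed.

Definition transvection w := involution_perm (rank1_mx w w).

Lemma transvectionE w x : Q w = 1 -> transvection w x = x + B x w *: w.
Proof. by move=> Qw; rewrite involution_permE ?rank1_involution // mul_rank1_mx. Qed.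

Lemma transvection_isometry w : Q w = 1 -> transvection w \in isometry_group Q.
Proof. by move=> Qw; apply/involution_perm_isometry/rank1_involution. Qed.

Lemma transvectionV w : Q w = 1 -> ((transvection w)^-1 = transvection w)%g.
Proof.
move=> Qw; apply/eqP; rewrite eq_invg_mul; apply/eqP.
exact: involution_perm_square (rank1_involution Qw).
Qed.

Lemma involution_perm_step N w : N \in involution_mxs -> w *m N = 0 -> Q w = 1 ->
  involution_perm (N + rank1_mx w w) = (transvection w * involution_perm N)%g.
Proof.
move=> invN wN Qw; apply/permP => x; rewrite permM transvectionE //.
rewrite !involution_permE ?step_invol // step_act mulmxDl -scalemxAl wN scaler0 addr0.
by rewrite addrA addrAC.
Qed.

Lemma isometry_polar g u v : g \in isometry_group Q -> B (g u) (g v) = B u v.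
Proof.
move=> /isometry_setP[lg Qg]; rewrite /polar.
by have := lg 1 u v; rewrite !scale1r => <-; rewrite !Qg.
Qed.

Lemma transvection_conj w g : Q w = 1 -> g \in isometry_group Q ->
  ((transvection w) ^ g = transvection (g w))%g.
Proof.
move=> Qw Og; have /isometry_setP[lg Qg] := Og.
apply/permP => x; rewrite /conjg !permM transvectionE // transvectionE ?Qg //.
have -> : B ((g^-1)%g x) w = B x (g w).
  by rewrite -(isometry_polar ((g^-1)%g x) w Og) permKV.
by rewrite [_ + B x (g w) *: w]addrC lg permKV addrC.
Qed.

Section LargeDimension.
Hypothesis d_gt4 : (4 < d)%N.

(** The common orthogonal of [w] and [u] has dimension at least [d - 2], which exceeds [d / 2] since
    [d > 4]. By [singular_coset_rank], [Q] cannot vanish on a coset of it. *)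
Lemma nonsingular_in_perp x w u :
  exists y, [/\ B y w = 0, B y u = 0 & Q (x + y) != 0].
Proof.
pose U := kermx (gram *m row_mx w^T u^T).
have rkU : (d - 2 <= \rank U)%N.
  by rewrite mxrank_ker leq_sub2l // (leq_trans (rank_leq_col _)).
have /existsP[y /andP[yU Qy]] : [exists y, (y <= U)%MS && (Q (x + y) != 0)].
  apply: contraT; rewrite negb_exists => /forallP H.
  have : (2 * \rank U <= d)%N.
    apply: (@singular_coset_rank _ _ x) => y yU; apply/eqP.
    by have := H y; rewrite yU /= negbK.
  by move: d_gt4 rkU; lia.
exists y; move: yU => /sub_kermxP; rewrite mulmxA mul_mx_row -[X in _ = X]row_mx0.
by move=> /eq_row_mx[yw yu]; rewrite !polarE yw yu !mxE.
Qed.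

Lemma exists_nonsingular : exists w, Q w = 1.
Proof.
have [y [_ _ Qy]] := nonsingular_in_perp 0 0 0.
have [r rE] := sqrt_exists_pchar2 F2.
by exists (r (Q (0 + y))^-1 *: (0 + y)); rewrite quadZ rE mulVf.
Qed.

(** Some [x] lies off both hyperplanes. Adding a vector orthogonal to [w] and [u] makes it
    nonsingular without changing the two products, and rescaling gives value 1. *)
Lemma nonsingular_off_perps w u : Q w = 1 -> Q u = 1 ->
  exists x, [/\ Q x = 1, B x w != 0 & B x u != 0].
Proof.
have [r rE] := sqrt_exists_pchar2 F2.
move=> Qw Qu.
have nz v : Q v = 1 -> v != 0.
  by apply: contra_eqN => /eqP ->; rewrite quad0 eq_sym oner_eq0.
have [a aw] := exists_polar1 (nz w Qw).
have [b bu] := exists_polar1 (nz u Qu).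
have [x [xw xu]] : exists x, B x w != 0 /\ B x u != 0.
  have [au|au] := eqVneq (B a u) 0; last by exists a; rewrite aw oner_eq0.
  have [bw|bw] := eqVneq (B b w) 0; last by exists b; rewrite bu oner_eq0.
  by exists (a + b); rewrite !polarDl aw au bw bu addr0 add0r oner_eq0.
have [y [yw yu Qy]] := nonsingular_in_perp x w u.
exists (r (Q (x + y))^-1 *: (x + y)); rewrite quadZ rE mulVf //.
have rn : r (Q (x + y))^-1 != 0 by rewrite -sqrf_eq0 rE invr_eq0.
by rewrite !polarZl !polarDl yw yu !addr0 !mulf_neq0.
Qed.

(** If [B v x != 0], the transvection along a multiple of [v + x] carries [v] to [x], so the product
    is a commutator. In general, insert twice a transvection along a vector orthogonal to
    neither. *)
Lemma transvectionM_Omega w u : Q w = 1 -> Q u = 1 ->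
  (transvection w * transvection u)%g \in Omega Q.
Proof.
have [r rE] := sqrt_exists_pchar2 F2.
have adj v x : Q v = 1 -> Q x = 1 -> B v x != 0 ->
    (transvection v * transvection x)%g \in Omega Q.
  (* The scalar normalizes [v + x], because [Q (v + x) = B v x] in characteristic 2. *)
  move=> Qv Qx Bvx; pose c := r (B v x)^-1; pose z := c *: (v + x).
  have cc : c * (c * B v x) = 1 by rewrite mulrA -expr2 rE mulVf.
  have Qz : Q z = 1.
    by rewrite quadZ quadD Qv Qx (addrr_pchar2 F2) add0r rE mulVf.
  have zv : transvection z v = x.
    rewrite transvectionE // polarZr polarDr polarxx add0r scalerA mulrC cc scale1r.
    by rewrite addrA (addmm_pchar2 F2) add0r.
  rewrite -zv -transvection_conj ?transvection_isometry //.
  rewrite -{1}(transvectionV Qv) -commgEl.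
  by apply: mem_commg; apply: transvection_isometry.
move=> Qw Qu; have [x [Qx xw xu]] := nonsingular_off_perps Qw Qu.
have -> : (transvection w * transvection u =
    (transvection w * transvection x) * (transvection x * transvection u))%g.
  by rewrite -mulgA (mulgA (transvection x)) -{1}(transvectionV Qx) mulVg mul1g.
by apply: groupM; apply: adj => //; rewrite polarC.
Qed.

(* For nonsingular [e] orthogonal to the singular vector [a], with [Q e = 1],
   the product of the transvections along [e] and [e + a] is
   [x |-> x + B x e *: a + B x a *: e + B x a *: a]; take [e = c] and [e = b + c]. *)
Lemma siegel_transvections N a b : N \in involution_mxs ->
  N + siegel_mx a b \in involution_mxs -> N *m siegel_mx a b = 0 ->
  [/\ Q a = 0, Q b = 0 & B a b = 0] ->
  exists2 E, E \in Omega Q &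
    involution_perm (N + siegel_mx a b) = (involution_perm N * E)%g.
Proof.
move=> invN invN' NS [Qa Qb Bab].
have [c [ca cb Qc]] : exists c, [/\ B c a = 0, B c b = 0 & Q c = 1].
  have [y [ya yb]] := nonsingular_in_perp 0 a b; rewrite add0r => Qy.
  have [r rE] := sqrt_exists_pchar2 F2.
  by exists (r (Q y)^-1 *: y); rewrite !polarZl ya yb !mulr0 quadZ rE mulVf.
have Qca : Q (c + a) = 1 by rewrite quadD Qc Qa ca !addr0.
have Qbc : Q (b + c) = 1 by rewrite quadD Qb Qc polarC cb addr0 add0r.
have Qbca : Q (b + c + a) = 1 by rewrite quadD Qbc Qa polarDl ca polarC Bab !addr0.
exists ((transvection c * transvection (c + a)) *
        (transvection (b + c) * transvection (b + c + a)))%g.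
  by apply: groupM; apply: transvectionM_Omega.
apply/permP => x; rewrite !permM (transvectionE _ Qbca) (transvectionE _ Qbc).
rewrite (transvectionE _ Qca) (transvectionE _ Qc) !involution_permE //.
have := congr1 (mulmx x) NS; rewrite mulmx0 mulmxA mul_siegel_mx mulmxDr mul_siegel_mx addrA.
set y := x + x *m N => NS0.
have yE : B x a *: b + B x b *: a = B y a *: b + B y b *: a.
  by rewrite -[LHS]addr0 -NS0 addrACA -(scalerDl b) -(scalerDl a) -!polarDl.
have [ac bc] : B a c = 0 /\ B b c = 0 by rewrite !(polarC _ c).
rewrite yE {yE}; clearbody y; apply/rowP => i.
rewrite !polar_simp ac bc ca cb (polarC b a) Bab !(mulr0, addr0, add0r) !mxE.
set Ba := B y a; set Bb := B y b; set Bc := B y c; move: (y 0 i) => yi.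
(* The four transvections produce each term of [z] twice; these cancel in characteristic 2. *)
pose z := (Bb + Bc) * b 0 i + (Bc + Ba) * a 0 i + (Bc + Bc + Ba + Bb) * c 0 i.
by rewrite -[LHS]addr0 -(addrr_pchar2 F2 z) /z; ring.
Qed.

(** The odd case carries an extra transvection, so that every step of the induction multiplies by an
    even number of them. *)
Lemma involution_perm_Omega N : N \in involution_mxs ->
  if odd (\rank N)
  then forall w, Q w = 1 -> (transvection w * involution_perm N)%g \in Omega Q
  else involution_perm N \in Omega Q.
Proof.
move: N; apply: involution_mxs_ind.
- by rewrite mxrank0 /= involution_perm0; apply: group1.
- move=> N a b [invN _ IH] Qab NS invN' _ rkE.
  have [E OmE ->] := siegel_transvections invN invN' NS Qab.
  move: IH; rewrite rkE /= negbK; case: odd => [IH w Qw|IH].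
    by rewrite mulgA; apply: groupM OmE; apply: IH.
  exact: groupM.
move=> N w [invN IH] wN Qw invN' _ rkE.
rewrite (involution_perm_step invN wN Qw) rkE /=.
case: odd IH => [IH|IH u Qu] /=; first exact: IH.
by rewrite mulgA; apply: groupM IH; apply: transvectionM_Omega.
Qed.

End LargeDimension.

(** * The Dickson invariant *)

Lemma mx_delta_form (A : 'M[F]_d) i j :
  ((delta_mx 0 i : 'rV_d) *m A *m (delta_mx 0 j : 'rV_d)^T) 0 0 = A i j.
Proof. by rewrite trmx_delta -colE mxE -rowE mxE. Qed.

Lemma mxD00 (A A' : 'M[F]_1) : (A + A') 0 0 = A 0 0 + A' 0 0.
Proof. exact: mxE. Qed.

Definition upper_part (A : 'M[F]_d) : 'M[F]_d := \matrix_(i, j) (A i j *+ (i < j)%N).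

Lemma alternating_upper_part (A : 'M[F]_d) :
  (forall x, (x *m A *m x^T) 0 0 = 0) -> A = upper_part A + (upper_part A)^T.
Proof.
move=> altA.
have Aii i : A i i = 0 by rewrite -mx_delta_form altA.
have Aij i j : A j i = A i j.
  have := altA (delta_mx 0 i + delta_mx 0 j).
  rewrite linearD /= !mulmxDl !mulmxDr !mxD00 !mx_delta_form !Aii add0r addr0.
  by move/eqP; rewrite addr_eq0 (oppr_pchar2 F2) => /eqP.
apply/matrixP => i j; rewrite !mxE.
by have [ij|ij|/val_inj ->] := ltngtP i j; rewrite ?Aii ?addr0 ?add0r // Aij.
Qed.

Local Notation C := (invmx gram).

Lemma invmx_gram_sym : C^T = C.
Proof. by rewrite trmx_inv gram_sym. Qed.

Lemma invmx_gram_alternating x : (x *m C *m x^T) 0 0 = 0.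
Proof.
have := polarxx (x *m C).
by rewrite polarE mulmxKV ?gram_unit // trmx_mul invmx_gram_sym mulmxA.
Qed.

(** Write [C = U + U^T]. The two traces [\tr (U *m K)] and [\tr (U^T *m K)] agree by transposition,
    so they cancel. *)
Lemma trace_alternating_sym (K : 'M[F]_d) : K^T = K -> \tr (C *m K) = 0.
Proof.
move=> symK; rewrite (alternating_upper_part invmx_gram_alternating) mulmxDl mxtraceD.
by rewrite -[X in _ + X]mxtrace_tr trmx_mul trmxK symK mxtrace_mulC (addrr_pchar2 F2).
Qed.

Lemma exists_bilinear_form :
  {P : 'M[F]_d | P + P^T = gram & forall x, (x *m P *m x^T) 0 0 = Q x}.
Proof.
pose P := upper_part gram + diag_mx (\row_i Q (delta_mx 0 i)).
have PD : P + P^T = gram.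
  rewrite /P linearD /= tr_diag_mx addrACA addmm_pchar2 // addr0.
  by rewrite -alternating_upper_part // => x; rewrite -polarE polarxx.
have: forall i, P i i = Q (delta_mx 0 i) by move=> i; rewrite !mxE eqxx ltnn add0r.
move: P PD => P PD Pe; exists P => // x.
(* [f] is additive, scales by squares and vanishes on the standard basis, hence is zero. *)
pose f y := Q y + (y *m P *m y^T) 0 0.
have fD y z : f (y + z) = f y + f z.
  have cross : (z *m P *m y^T) 0 0 = (y *m P^T *m z^T) 0 0.
    transitivity ((z *m P *m y^T)^T 0 0); first by rewrite [RHS]mxE.
    by rewrite !trmx_mul trmxK mulmxA.
  have BE : B y z = (y *m P *m z^T) 0 0 + (z *m P *m y^T) 0 0.
    by rewrite cross polarE -PD mulmxDr mulmxDl mxD00.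
  rewrite /f quadD linearD /= !mulmxDl !mulmxDr !mxD00 BE.
  set p := (y *m P *m z^T) 0 0; set r := (z *m P *m y^T) 0 0.
  by rewrite -[RHS]addr0 -(addrr_pchar2 F2 (p + r)); ring.
have fZ a y : f (a *: y) = a ^+ 2 * f y.
  by rewrite /f quadZ linearZ -!scalemxAl -scalemxAr !mxE; ring.
have f0 : f 0 = 0 by rewrite /f quad0 !mul0mx mxE addr0.
have fe i : f (delta_mx 0 i) = 0.
  by rewrite /f mx_delta_form Pe (addrr_pchar2 F2).
have : f x = 0.
  rewrite [x]row_sum_delta (big_morph f fD f0) big1 // => i _.
  by rewrite fZ fe mulr0.
by move=> /eqP; rewrite addr_eq0 (oppr_pchar2 F2) => /eqP.
Qed.

Definition half_form : 'M[F]_d := s2val exists_bilinear_form.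
Local Notation P := half_form.

Lemma half_formD : P + P^T = gram.
Proof. exact: s2valP exists_bilinear_form. Qed.

Lemma half_formE x : (x *m P *m x^T) 0 0 = Q x.
Proof. exact: s2valP' exists_bilinear_form x. Qed.

Definition isometry_mx (G : 'M[F]_d) := forall v, Q (v *m G) = Q v.

Lemma isometry_mx_gram G : isometry_mx G -> G^T *m C *m G = C.
Proof.
move=> QG; have GJ : G *m gram *m G^T = gram.
  apply/matrixP => i j; rewrite -!mx_delta_form !mulmxA -[_ *m G^T *m _]mulmxA -trmx_mul.
  by rewrite -!polarE /polar -mulmxDl !QG.
have uG : G \in unitmx.
  have := gram_unit; rewrite -GJ -mulmxA unitmx_mul => /andP[//].
have uGT : G^T \in unitmx by rewrite unitmx_tr.
have uJG : gram *m G^T \in unitmx by rewrite unitmx_mul gram_unit.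
by apply: (can_inj (mulmxK uJG)); rewrite !mulmxA mulVmx ?gram_unit // mul1mx
  -!mulmxA (mulmxA G) GJ mulVmx ?gram_unit // mulmx1.
Qed.

(* [dickson G] does not depend on the choice of [L] with
   [G *m P *m G^T + P = L + L^T], see [dicksonE]. *)
Definition dickson (G : 'M[F]_d) : F :=
  \tr (C *m upper_part (G *m P *m G^T + P)).

(** Two choices of [L] differ by a symmetric matrix, whose trace against [C] vanishes. *)
Lemma dicksonE G L : G *m P *m G^T + P = L + L^T -> dickson G = \tr (C *m L).
Proof.
move=> GL; set M := upper_part (G *m P *m G^T + P).
have LM : L + L^T = M + M^T.
  rewrite /M -alternating_upper_part // GL => x.
  rewrite mulmxDr mulmxDl mxD00.
  have -> : x *m L^T *m x^T = (x *m L *m x^T)^T by rewrite !trmx_mul trmxK mulmxA.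
  by rewrite [X in _ + X]mxE (addrr_pchar2 F2).
have sym : (M + L)^T = M + L.
  apply/eqP; rewrite linearD /= -subr_eq0 (oppmx_pchar2 F2) addrACA.
  by rewrite [_ + M]addrC [_ + L]addrC LM (addmm_pchar2 F2).
have /eqP := trace_alternating_sym sym.
by rewrite mulmxDr mxtraceD addr_eq0 (oppr_pchar2 F2) => /eqP.
Qed.

Lemma dickson_alternating G : isometry_mx G ->
  exists L, G *m P *m G^T + P = L + L^T.
Proof.
move=> QG; exists (upper_part (G *m P *m G^T + P)); apply: alternating_upper_part => x.
rewrite mulmxDr mulmxDl mxD00 !mulmxA -[_ *m G^T *m _]mulmxA -trmx_mul.
by rewrite !half_formE QG (addrr_pchar2 F2).
Qed.

(** If [L] and [M] serve for [G] and [H], then [G *m M *m G^T + L] serves for [G *m H]. Cyclicity of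
    the trace and [G^T *m C *m G = C] remove the conjugation. *)
Lemma dicksonM G H : isometry_mx G -> isometry_mx H ->
  dickson (G *m H) = dickson G + dickson H.
Proof.
move=> QG QH; have [L GL] := dickson_alternating QG; have [M HM] := dickson_alternating QH.
rewrite (dicksonE GL) (dicksonE HM).
have : G *m H *m P *m (G *m H)^T + P = (G *m M *m G^T + L) + (G *m M *m G^T + L)^T.
  rewrite [RHS](_ : _ = G *m (M + M^T) *m G^T + (L + L^T)); last first.
    by rewrite linearD /= !trmx_mul trmxK addrACA mulmxA -mulmxDl -mulmxDr.
  rewrite -HM -GL mulmxDr mulmxDl trmx_mul !mulmxA.
  by rewrite -[RHS]addrA [in RHS](addrA (G *m P *m G^T)) addmm_pchar2 // add0r.
move/dicksonE->; rewrite mulmxDr mxtraceD addrC; congr (_ + _).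
by rewrite mulmxA mxtrace_mulC !mulmxA isometry_mx_gram.
Qed.

(** Here [p *m l^T] is a possible [L], and its trace against [C] is [l^T *m C *m p = w *m P *m w^T],
    that is [Q w]. *)
Lemma dickson_transvection w : Q w = 1 -> dickson (1%:M + rank1_mx w w) = 1.
Proof.
move=> Qw; pose l := gram *m w^T; pose p := P *m w^T.
have wP : w *m P = p^T + l^T.
  transitivity (p + l)^T; last by rewrite linearD.
  rewrite /p /l -half_formD (mulmxDl P) addrA addmm_pchar2 // add0r.
  by rewrite trmx_mul !trmxK.
have rT : (rank1_mx w w)^T = w^T *m l^T by rewrite trmx_mul.
have : (1%:M + rank1_mx w w) *m P *m (1%:M + rank1_mx w w)^T + P =
    p *m l^T + (p *m l^T)^T.
  rewrite [(1%:M + _)^T]linearD /= trmx1 rT mulmxDl mul1mx mulmxDr mulmx1 mulmxDl.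
  have -> : rank1_mx w w *m P = l *m p^T + l *m l^T.
    by rewrite /rank1_mx -mulmxA wP mulmxDr.
  rewrite !mulmxA -/p.
  have -> : (l *m p^T + l *m l^T) *m w^T *m l^T = l *m l^T.
    rewrite -mulmxDr -wP -(mulmxA l) [w *m P *m w^T]mx11_scalar.
    by rewrite half_formE Qw mulmx1.
  rewrite [(p *m _)^T]trmx_mul trmxK addrC !addrA addmm_pchar2 // add0r (addrAC _ (l *m l^T)).
  by rewrite (addmK_pchar2 F2) addrC.
move/dicksonE->; have lT : l^T = w *m gram by rewrite trmx_mul trmxK gram_sym.
rewrite mulmxA mxtrace_mulC mulmxA lT mulmxK ?gram_unit // trace_mx11.
by rewrite mulmxA half_formE.
Qed.

Definition perm_mx_of (g : {perm 'rV[F]_d}) : 'M[F]_d := \matrix_i g (delta_mx 0 i).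

Lemma mul_perm_mx_of g x : g \in isometry_group Q -> x *m perm_mx_of g = g x.
Proof.
move=> /isometry_setP[lg _].
have g0 : g 0 = 0 by have := lg (-1) 0 0; rewrite scaler0 addr0 scaleN1r addNr.
have gD u v : g (u + v) = g u + g v by have := lg 1 u v; rewrite !scale1r.
have gZ a u : g (a *: u) = a *: g u by have := lg a u 0; rewrite !addr0 g0 addr0.
rewrite {2}[x]row_sum_delta (big_morph g gD g0) mulmx_sum_row.
by apply: eq_bigr => i _; rewrite gZ rowK.
Qed.

Lemma perm_mx_of_isometry g : g \in isometry_group Q -> isometry_mx (perm_mx_of g).
Proof. by move=> Og v; rewrite mul_perm_mx_of //; have /isometry_setP[] := Og. Qed.

Definition perm_dickson g := dickson (perm_mx_of g).

Lemma perm_dicksonM g h : g \in isometry_group Q -> h \in isometry_group Q ->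
  perm_dickson (g * h)%g = perm_dickson g + perm_dickson h.
Proof.
move=> Og Oh; rewrite /perm_dickson -dicksonM; try exact: perm_mx_of_isometry.
congr dickson; apply: eqmx_act => x.
by rewrite mulmxA !mul_perm_mx_of ?groupM // permM.
Qed.

Lemma perm_dickson1 : perm_dickson 1%g = 0.
Proof.
have O1 : 1%g \in isometry_group Q by exact: group1.
by apply: (addrI (perm_dickson 1%g)); rewrite -perm_dicksonM // mulg1 addr0.
Qed.

Lemma perm_dickson_Omega g : g \in Omega Q -> perm_dickson g = 0.
Proof.
pose K := [set g in isometry_group Q | perm_dickson g == 0].
have memK (h : {perm 'rV[F]_d}) :
    (h \in K) = (h \in isometry_group Q) && (perm_dickson h == 0).
  by rewrite finset.in_set.
have Kgroup : group_set K.
  apply/group_setP; split=> [|x y]; first by rewrite memK group1 perm_dickson1 eqxx.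
  rewrite !memK => /andP[Ox /eqP Dx] /andP[Oy /eqP Dy].
  by rewrite groupM // perm_dicksonM // Dx Dy addr0 eqxx.
suff : Omega Q \subset Group Kgroup.
  by move=> /fintype.subsetP sub /sub; rewrite memK => /andP[_ /eqP].
rewrite gen_subG; apply/fintype.subsetP => _ /imset2P[x y Ox Oy ->].
rewrite memK groupR //=.
have Vx : perm_dickson x^-1%g + perm_dickson x = 0.
  by rewrite -perm_dicksonM ?groupV // mulVg perm_dickson1.
have Vy : perm_dickson y^-1%g + perm_dickson y = 0.
  by rewrite -perm_dicksonM ?groupV // mulVg perm_dickson1.
rewrite /commg /conjg !perm_dicksonM ?groupM ?groupV //.
by rewrite [perm_dickson (y^-1)%g + _]addrCA Vy addr0 Vx.
Qed.

Lemma perm_dickson_transvection w : Q w = 1 -> perm_dickson (transvection w) = 1.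
Proof.
move=> Qw; rewrite -(dickson_transvection Qw); congr dickson; apply: eqmx_act => x.
rewrite mul_perm_mx_of ?transvection_isometry // transvectionE //.
by rewrite mulmxDr mulmx1 mul_rank1_mx.
Qed.

(** In odd rank, membership would force a transvection into [Omega Q], against its Dickson invariant
    1. *)
Lemma involution_perm_OmegaE N : (4 < d)%N -> N \in involution_mxs ->
  (involution_perm N \in Omega Q) = ~~ odd (\rank N).
Proof.
move=> d4 invN; have := involution_perm_Omega d4 invN.
case: ifP => //= _ tN; have [w Qw] := exists_nonsingular d4.
apply/negP => pN; have := tN w Qw; rewrite groupMr // => /perm_dickson_Omega /eqP.
by rewrite perm_dickson_transvection // oner_eq0.
Qed.

Lemma num_involutions_rank : (4 < d)%N ->
  num_involutions (isometry_group Q :\: Omega Q) =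
  #|[set N in involution_mxs | odd (\rank N)]|.
Proof.
move=> d4; rewrite -[RHS](card_in_imset (f := involution_perm)); last first.
  by move=> N M; rewrite !finset.in_set => /andP[invN _] /andP[invM _]; apply: involution_perm_inj;
    rewrite finset.in_set.
apply: eq_card => g; rewrite finset.in_set finset.in_setD; apply/idP/imsetP.
  move=> /andP[/andP[gOm Og] /eqP g2].
  have gg x : g (g x) = x by rewrite -permM -expg2 g2 perm1.
  pose N := perm_mx_of g + 1%:M.
  have actN x : x *m N = g x + x by rewrite mulmxDr mulmx1 mul_perm_mx_of.
  have /isometry_setP[lg Qg] := Og.
  have gD u v : g (u + v) = g u + g v by have := lg 1 u v; rewrite !scale1r.
  have invN : N \in involution_mxs.
    apply/involution_mxsP; split=> [|x].
      apply: eqmx_act => x; rewrite mulmx0 mulmxA !actN gD gg [x + _]addrC.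
      by rewrite addmm_pchar2.
    by rewrite actN quadD Qg (addrr_pchar2 F2) add0r polarDr polarxx addr0 polarC.
  have gE : g = involution_perm N.
    by apply/permP => x; rewrite involution_permE // actN addrC (addmK_pchar2 F2).
  exists N => //; rewrite finset.in_set invN /=.
  by move: gOm; rewrite gE involution_perm_OmegaE // negbK.
move=> [N]; rewrite finset.in_set => /andP[invN oddN] ->.
by rewrite involution_perm_OmegaE // oddN involution_perm_isometry //
  involution_perm_square // eqxx.
Qed.

Lemma num_involutions_sum : (4 < d)%N ->
  num_involutions (isometry_group Q :\: Omega Q) =
  (\sum_(k < d./2.+1 | odd k) #|nonalternating_rank k|)%N.
Proof.
move=> d4; rewrite num_involutions_rank //.
have rkP N : N \in involution_mxs -> (\rank N < d./2.+1)%N.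
  by move=> /invol_rank; lia.
rewrite -sum1_card (eq_bigl (fun N => (N \in involution_mxs) && odd (\rank N))); last first.
  by move=> N; rewrite finset.in_set.
rewrite (partition_big (fun N => inord (\rank N) : 'I_d./2.+1) (fun k => odd k)) /=; last first.
  by move=> N /andP[/rkP rkN oddN]; rewrite inordK.
apply: eq_bigr => k oddk; rewrite -sum1_card; apply: eq_bigl => N.
rewrite [RHS]finset.in_set -andbA; case invN: (N \in involution_mxs) => //=.
have -> : (inord (\rank N) == k) = (\rank N == k).
  by rewrite -val_eqE /= inordK // rkP.
rewrite andbC; case: eqP => //= rkE; rewrite rkE oddk; apply/esym/negP.
by move/(alternating_rank_even invN); rewrite rkE oddk.
Qed.

End NonDefectiveForm.

(** * The q-binomial theorem and the sum over odd ranks *)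

Section QPochhammer.
Variables (R : realType) (t : R).
Hypotheses (t_gt0 : 0 < t) (t_lt1 : t < 1).

Definition qpoch (m : nat) : R := \prod_(i < m) (1 - t ^+ i.+1).

Lemma qpoch0 : qpoch 0 = 1. Proof. by rewrite /qpoch big_ord0. Qed.

Lemma qpochS m : qpoch m.+1 = qpoch m * (1 - t ^+ m.+1).
Proof. by rewrite /qpoch big_ord_recr. Qed.

Lemma qpoch_gt0 m : 0 < qpoch m.
Proof.
by apply: prodr_gt0 => i _; rewrite subr_gt0 exprn_ilt1 // ltW.
Qed.

Lemma qpoch_neq0 m : qpoch m != 0. Proof. exact: lt0r_neq0 (qpoch_gt0 m). Qed.

(** The Gaussian binomial for [j <= m]; beyond that, the truncated [m - j] gives [qpoch m / qpoch j]
    rather than 0. *)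
Definition qbinom m j : R := qpoch m / (qpoch j * qpoch (m - j)).

Lemma qbinom_ge0 m j : 0 <= qbinom m j.
Proof. by rewrite divr_ge0 ?mulr_ge0 ?ltW ?qpoch_gt0. Qed.

Lemma qbinomn0 m : qbinom m 0 = 1.
Proof. by rewrite /qbinom subn0 qpoch0 mul1r divff ?qpoch_neq0. Qed.

Lemma qbinomnn m : qbinom m m = 1.
Proof. by rewrite /qbinom subnn qpoch0 mulr1 divff ?qpoch_neq0. Qed.

Lemma qbinomS m j : (j < m)%N ->
  qbinom m.+1 j.+1 = qbinom m j.+1 + t ^+ (m - j) * qbinom m j.
Proof.
move=> jm; rewrite /qbinom subSS -(subnSK jm).
set k := (m - j.+1)%N; have -> : m = (j + k).+1 by rewrite /k; lia.
rewrite !qpochS.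
have := qpoch_neq0 j; have := qpoch_neq0 k.
have : 1 - t ^+ k.+1 != 0 by rewrite lt0r_neq0 // subr_gt0 exprn_ilt1 // ltW.
have : 1 - t ^+ j.+1 != 0 by rewrite lt0r_neq0 // subr_gt0 exprn_ilt1 // ltW.
have -> : t ^+ (j + k).+2 = t ^+ j.+1 * t ^+ k.+1 by rewrite -exprD; congr (_ ^+ _); lia.
move: (qpoch j) (qpoch k) (t ^+ j.+1) (t ^+ k.+1) (qpoch (j + k)) (t ^+ (j + k).+1).
by move=> a b c e f g h1 h2 h3 h4; field; apply/and4P.
Qed.

Lemma qbinomial_theorem (z : R) m :
  \prod_(i < m) (1 + z * t ^+ i) =
  \sum_(j < m.+1) t ^+ 'C(j, 2) * z ^+ j * qbinom m j.
Proof.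
elim: m => [|m IHm].
  by rewrite big_ord0 big_ord1 qbinomnn !mulr1 expr0.
rewrite big_ord_recr /= IHm mulrDr mulr1.
rewrite [in RHS]big_ord_recl [in RHS]big_ord_recr /=.
rewrite [X in X + _ = _]big_ord_recl [X in _ + X = _]mulr_suml.
rewrite [X in _ + X = _]big_ord_recr /=.
rewrite !qbinomn0 !qbinomnn -!addrA; congr (_ + _).
rewrite addrA -big_split /=; congr (_ + _).
  apply: eq_bigr => j _; rewrite /bump /= add1n binS bin1 qbinomS //.
  have tE : t ^+ m = t ^+ j * t ^+ (m - j) by rewrite -exprD subnKC // ltnW.
  by rewrite tE exprD exprS; ring.
by rewrite /bump /= add1n binS bin1 exprD exprS; ring.
Qed.

(** The ratio is a product of factors [1 - t ^+ i] with [r < i <= s]. The summand [t ^+ s]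
    strengthens the bound enough for induction on [s], where [t <= 1/2] enters. *)
Lemma qpoch_ratio_ge r s : t <= 2^-1 -> (r <= s)%N ->
  1 - t ^+ r + t ^+ s <= qpoch s / qpoch r.
Proof.
move=> t2 /subnKC <-; elim: (s - r)%N => [|k IHk].
  by rewrite addn0 divff ?qpoch_neq0 // subrK.
rewrite addnS qpochS mulrAC.
have ts0 : 0 <= t ^+ (r + k) by rewrite exprn_ge0 // ltW.
have tr1 : t ^+ (r + k) <= t ^+ r by rewrite ler_wiXn2l ?ltW // leq_addr.
apply: le_trans (_ : (1 - t ^+ r + t ^+ (r + k)) * (1 - t ^+ (r + k).+1) <= _).
  rewrite exprS; move: tr1 ts0; set a := t ^+ r; set b := t ^+ (r + k) => tr1 ts0.
  rewrite -subr_ge0.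
  have -> : (1 - a + b) * (1 - t * b) - (1 - a + t * b) =
    b * ((1 - 2 * t) + t * (a - b)) by ring.
  have t0 : 0 <= t by exact: ltW.
  by rewrite mulr_ge0 // addr_ge0 ?mulr_ge0 ?subr_ge0 //; lra.
by apply: ler_wpM2r => //; rewrite subr_ge0 exprn_ile1 // ltW.
Qed.

Lemma qpoch_ratio_le1 r s : (r <= s)%N -> qpoch s / qpoch r <= 1.
Proof.
move=> /subnKC <-; elim: (s - r)%N => [|k IHk]; first by rewrite addn0 divff ?qpoch_neq0.
rewrite addnS qpochS mulrAC; apply: mulr_ile1 => //.
- by rewrite divr_ge0 // ltW ?qpoch_gt0.
- by rewrite subr_ge0 exprn_ile1 // ltW.
by rewrite gerBl exprn_ge0 // ltW.
Qed.

End QPochhammer.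

(** * The normalized sum over odd ranks and its comparison with Gaussian binomials *)

Section InvolutionSum.
Variables (R : realType) (x : R).
Hypotheses (x_gt0 : 0 < x) (x_le2 : x <= 2^-1).
Local Notation t := (x ^+ 2).

Let t_gt0 : 0 < t. Proof. exact: exprn_gt0. Qed.
Let x_le1 : x <= 1. Proof. by have := x_le2; lra. Qed.
Let x_ge0 : 0 <= x. Proof. exact: ltW. Qed.
Let t_ge0 : 0 <= t. Proof. exact: ltW. Qed.
Let t_le4 : t <= 1 / 4.
Proof.
have -> : (1 / 4 : R) = 2^-1 * 2^-1 by lra.
by rewrite expr2 ler_pM.
Qed.
Let t_le2 : t <= 2^-1. Proof. by have := t_le4; lra. Qed.
Let t_lt1 : t < 1. Proof. by have := t_le2; lra. Qed.

Definition odd_prod (y : R) m := \prod_(i < m) (1 + y ^+ (2 * i + 1)).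

Lemma odd_prod_sum (y : R) m : y ^+ 2 = t ->
  odd_prod y m = \sum_(j < m.+1) y ^+ (j ^ 2) * qbinom t m j.
Proof.
move=> yt; have E := qbinomial_theorem t_gt0 t_lt1 y m.
rewrite /odd_prod (eq_bigr (fun i : 'I_m => 1 + y * t ^+ i)) => [|i _]; last first.
  by rewrite addn1 exprS exprM yt.
rewrite E; apply: eq_bigr => j _; congr (_ * _).
rewrite -yt -exprM -exprD; congr (_ ^+ _).
have := bin2_sum j; have := mul_bin_diag j 1; rewrite bin1; case: (j : nat) => //= k.
by rewrite binS bin1 => *; lia.
Qed.

(** With [m = n - 1] and [j = n - k], odd [k] means even [m - j]. In [parity_sum] the index
    [(m - j)./2] becomes [m - j], which produces Gaussian binomials. *)
Definition involution_sum m :=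
  \sum_(j < m.+1 | ~~ odd (m - j))
    x ^+ (j ^ 2) * (qpoch t m / (qpoch t j * qpoch t (m - j)./2)).

Definition parity_sum m :=
  \sum_(j < m.+1 | ~~ odd (m - j)) x ^+ (j ^ 2) * qbinom t m j.

(** As [j ^ 2] has the parity of [j], passing from [x] to [- x] puts the sign [(-1)^j] on the terms,
    and a half sum or half difference selects one parity. *)
Lemma parity_sumE m :
  parity_sum m = 2^-1 * (odd_prod x m + (-1) ^+ m * odd_prod (- x) m).
Proof.
rewrite !odd_prod_sum ?sqrrN // mulr_sumr -big_split mulr_sumr /= /parity_sum big_mkcond.
apply: eq_bigr => j _; have jm : (j <= m)%N by rewrite -ltnS.
have -> : (- x) ^+ (j ^ 2) = (-1) ^+ j * x ^+ (j ^ 2).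
  by rewrite [LHS]exprNn -[in LHS](signr_odd _ (j ^ 2)) oddX /= signr_odd.
have -> : (-1) ^+ m = (-1) ^+ odd (m - j) * (-1) ^+ j :> R.
  by rewrite signr_odd -exprD subnK.
have jj : (-1) ^+ j * (-1) ^+ j = 1 :> R by rewrite -expr2 sqrr_sign.
set b := qbinom _ _ _; set y := x ^+ _.
have -> : (-1) ^+ odd (m - j) * (-1) ^+ j * ((-1) ^+ j * y * b) =
    (-1) ^+ odd (m - j) * (y * b).
  by move: ((-1) ^+ j) jj => e ee; rewrite -!mulrA (mulrA e e) ee mul1r.
by case: odd => /=; rewrite ?expr0 ?expr1; field.
Qed.

(** Termwise the two sums differ by the factor [qpoch t (m - j) / qpoch t (m - j)./2]. It lies
    between [1 - x ^+ (m - j)] and 1, since [t ^+ (m - j)./2 = x ^+ (m - j)] for even [m - j]. *)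
Lemma involution_sum_bounds m :
  parity_sum m - x ^+ m * \prod_(i < m) (1 + t ^+ i) <= involution_sum m <= parity_sum m.
Proof.
have termE j : (j <= m)%N ->
    x ^+ (j ^ 2) * (qpoch t m / (qpoch t j * qpoch t (m - j)./2)) =
    x ^+ (j ^ 2) * qbinom t m j * (qpoch t (m - j) / qpoch t (m - j)./2).
  move=> jm; rewrite /qbinom; have := qpoch_neq0 t_gt0 t_lt1 (m - j).
  have := qpoch_neq0 t_gt0 t_lt1 j; have := qpoch_neq0 t_gt0 t_lt1 (m - j)./2.
  by move=> h1 h2 h3; field; apply/and3P.
have half_le k : (k./2 <= k)%N by lia.
have pos j : 0 <= x ^+ (j ^ 2) * qbinom t m j.
  by rewrite mulr_ge0 ?qbinom_ge0 // exprn_ge0 // ltW.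
apply/andP; split; last first.
  apply: ler_sum => j _; rewrite termE -1?ltnS // ler_piMr //.
  exact: qpoch_ratio_le1.
(* The errors are summed by the q-binomial theorem at [z = 1], using
   [j^2 + (m - j) = m + 2 'C(j, 2)]. *)
have -> : \prod_(i < m) (1 + t ^+ i) = \prod_(i < m) (1 + 1 * t ^+ i).
  by apply: eq_bigr => i _; rewrite mul1r.
rewrite qbinomial_theorem // mulr_sumr lerBlDr -lerBlDl -sumrB.
rewrite [leRHS](bigID (fun j : 'I_m.+1 => ~~ odd (m - j))) /= -[leLHS]addr0.
apply: lerD; last first.
  apply: sumr_ge0 => j _; rewrite expr1n mulr1; apply: mulr_ge0; first exact: exprn_ge0.
  by apply: mulr_ge0; [exact: exprn_ge0 | exact: qbinom_ge0].
apply: ler_sum => j evj; have jm : (j <= m)%N by rewrite -ltnS.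
rewrite termE // -[X in X - _]mulr1 -mulrBr.
apply: le_trans (_ : x ^+ (j ^ 2) * qbinom t m j * x ^+ (m - j) <= _).
  apply: ler_wpM2l => //.
  have := qpoch_ratio_ge t_gt0 t_lt1 t_le2 (half_le (m - j)%N).
  have -> : t ^+ (m - j)./2 = x ^+ (m - j).
    by rewrite -exprM mul2n even_halfK.
  have : 0 <= t ^+ (m - j) by rewrite exprn_ge0 // ltW.
  move: (qpoch _ _ / _) (t ^+ (m - j)) (x ^+ (m - j)) => a b c; lra.
rewrite expr1n mulr1 mulrAC [leRHS]mulrA; apply: ler_wpM2r; first exact: qbinom_ge0.
rewrite -exprM -!exprD; have -> : (j ^ 2 + (m - j) = m + 2 * 'C(j, 2))%N.
  have := mul_bin_diag j 1; rewrite bin1; move: jm; case: (j : nat) => [|k] //=.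
    by rewrite /= => *; lia.
  by rewrite binS bin1 => *; nia.
by [].
Qed.

(** The factor for [i = 0] is 2 and the others are at most 5/4, as [t <= 1/4]; with [x <= 1/2] the
    rate is 5/8. *)
Lemma prod_error_bound m :
  x ^+ m * \prod_(i < m) (1 + t ^+ i) <= 2 * (5 / 8) ^+ m.
Proof.
have prod_le : \prod_(i < m) (1 + t ^+ i) <= 2 * (5 / 4) ^+ m.
  elim: m => [|m IHm]; first by rewrite big_ord0 expr0; lra.
  case: m IHm => [_|m IHm].
    by rewrite big_ord_recr big_ord0 /= mul1r expr0 expr1; lra.
  rewrite big_ord_recr /= [(5 / 4) ^+ m.+2]exprSr mulrA; apply: ler_pM => //.
  - by apply: prodr_ge0 => i _; rewrite addr_ge0 // exprn_ge0 // ltW.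
  - by rewrite addr_ge0 // exprn_ge0 // ltW.
  rewrite exprS; have : t ^+ m <= 1 by rewrite exprn_ile1 // ltW.
  have : 0 <= t ^+ m by rewrite exprn_ge0 // ltW.
  move: (t ^+ m) => a; move: t_le4 (t_gt0); move: t => b; nra.
have -> : (5 / 8 : R) = 2^-1 * (5 / 4) by lra.
rewrite exprMn mulrCA; apply: ler_pM => //; try by rewrite exprn_ge0 // ltW.
  by apply: prodr_ge0 => i _; rewrite addr_ge0 // exprn_ge0 // ltW.
by apply: lerXn2r => //; rewrite nnegrE; lra.
Qed.

(** The subtracted term makes the induction work, which needs [2 - 3x - 2x^2 = (1 - 2x)(2 + x)] to
    be nonnegative. *)
Lemma odd_prod_ub m : odd_prod x m <= 3 - 2 * x ^+ (2 * m).
Proof.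
elim: m => [|m IHm]; first by rewrite /odd_prod big_ord0 muln0 expr0; lra.
rewrite /odd_prod big_ord_recr /= -/(odd_prod x m).
apply: le_trans (_ : (3 - 2 * x ^+ (2 * m)) * (1 + x ^+ (2 * m + 1)) <= _).
  by apply: ler_wpM2r => //; rewrite addr_ge0 // exprn_ge0 // ltW.
have -> : (2 * m.+1 = 2 * m + 2)%N by lia.
rewrite (exprD x (2 * m) 2) (exprD x (2 * m) 1) expr1.
have a0 : 0 <= x ^+ (2 * m) by rewrite exprn_ge0 // ltW.
move: (x ^+ (2 * m)) a0 => a a0; rewrite -subr_ge0.
have -> : 3 - 2 * (a * x ^+ 2) - (3 - 2 * a) * (1 + a * x) =
  a * (2 - 3 * x - 2 * x ^+ 2) + 2 * (a * a * x) by ring.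
rewrite addr_ge0 ?mulr_ge0 //.
by have := t_le4; have := x_le2; move: t => b; lra.
Qed.

End InvolutionSum.

(** * Solving the recursion *)

Section ClosedForm.
Variables (R : realType) (q n : nat) (c : nat -> nat).
Hypotheses (q_gt1 : (1 < q)%N) (n_gt0 : (0 < n)%N).
Hypothesis c_rec : forall k, (0 < k < n)%N ->
  (c k.+1 * (q ^ k - ~~ odd k) = c k * (q ^ (n + n - k).-1 - q ^ k.-1))%N.

Let x : R := q%:R^-1.
Local Notation t := (x ^+ 2).

Let q_gt0 : 0 < q%:R :> R. Proof. by rewrite ltr0n ltnW. Qed.
Let q_neq0 : q%:R != 0 :> R. Proof. exact: lt0r_neq0. Qed.
Let x_gt0 : 0 < x. Proof. by rewrite invr_gt0. Qed.
Let x_lt1 : x < 1. Proof. by rewrite invf_lt1 // ltr1n. Qed.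
Let t_gt0 : 0 < t. Proof. exact: exprn_gt0. Qed.
Let t_lt1 : t < 1. Proof. by rewrite exprn_ilt1 // ltW. Qed.
Let expqx m : q%:R ^+ m * x ^+ m = 1 :> R.
Proof. by rewrite -exprMn divff ?expr1n. Qed.

Lemma recursion_closed_form k : (0 < k <= n)%N ->
  (c k)%:R / q%:R ^+ (n ^ 2) =
  (c 1)%:R * x ^+ (n + n).-1 * (x ^+ ((n - k) ^ 2) *
    (qpoch t n.-1 / (qpoch t (n - k) * qpoch t k.-1./2))).
Proof.
elim: k => [//|[_|k IHk]] /andP[_ kn].
  rewrite subn1 [qpoch _ 0]qpoch0 mulr1 divff ?qpoch_neq0 // mulr1 -mulrA -exprD.
  by rewrite -exprVn; congr (_ * _ ^+ _); rewrite -!mulnn; move: n_gt0; nia.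
have {}IHk := IHk (ltnW kn); have := c_rec (kn : (0 < k.+1 < n)%N).
pose j := (n - k.+2)%N.
have -> : ((n + n - k.+1).-1 = k.+1 + (2 * j + 1))%N by rewrite /j; lia.
have -> : (n - k.+2 = j)%N by [].
move: IHk; have -> : (n - k.+1 = j.+1)%N by rewrite /j; lia.
rewrite [k.+1.-1]/= [k.+2.-1]/= => IHk /(congr1 (fun m => m%:R : R)).
have qk : (q ^ k <= q ^ (k.+1 + (2 * j + 1)))%N.
  by rewrite leq_exp2l //; lia.
have dk : (~~ odd k.+1 <= q ^ k.+1)%N.
  by rewrite (leq_trans (leq_b1 _)) // expn_gt0 ltnW.
rewrite !natrM !natrB // !natrX => E.
pose dl : R := (~~ odd k.+1)%:R.
(* The recursion divided by [q ^ k.+1], with [q^(2j+1) - q^(-1) = q^(2j+1) (1 - t^(j+1))]. *)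
have E' : (c k.+2)%:R * (1 - dl * x ^+ k.+1) =
    (c k.+1)%:R * (q%:R ^+ (2 * j + 1) * (1 - t ^+ j.+1)).
  apply: (mulfI (lt0r_neq0 (exprn_gt0 k.+1 q_gt0))).
  transitivity ((c k.+2)%:R * (q%:R ^+ k.+1 - dl)).
    rewrite mulrCA mulrBr mulr1 mulrCA expqx mulr1 //.
  rewrite E [RHS]mulrCA; congr (_ * _); rewrite mulrA -exprD mulrBr mulr1; congr (_ - _).
  rewrite -exprM [RHS](_ : _ = q%:R ^+ k * (q%:R ^+ (2 * j.+1) * x ^+ (2 * j.+1))).
    by rewrite expqx mulr1.
  by rewrite mulrA -exprD; congr (_ ^+ _ * _); lia.
(* The halved index advances exactly when [k] is odd, which is when the correction [dl] is 1. *)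
have hE : qpoch t k.+1./2 = qpoch t k./2 * (1 - dl * x ^+ k.+1).
  rewrite /dl [odd k.+1]/= negbK; have [oddk|evk] := boolP (odd k); last first.
    have -> : k.+1./2 = k./2 by lia.
    by rewrite mul0r subr0 mulr1.
  have -> : k.+1./2 = k./2.+1 by lia.
  by rewrite qpochS -exprM mul1r; congr (_ * (1 - _ ^+ _)); lia.
have d0 : 1 - dl * x ^+ k.+1 != 0.
  have := qpoch_neq0 t_gt0 t_lt1 k.+1./2; rewrite hE mulf_eq0 negb_or.
  by case/andP.
have j0 : 1 - t ^+ j.+1 != 0.
  by rewrite lt0r_neq0 // subr_gt0 exprn_ilt1 // ltW.
have xE : x ^+ (j ^ 2) = x ^+ (j.+1 ^ 2) * q%:R ^+ (2 * j + 1).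
  have -> : (j.+1 ^ 2 = j ^ 2 + (2 * j + 1))%N by rewrite -addn1 sqrnD; lia.
  by rewrite (exprD x (j ^ 2)) -mulrA (mulrC (x ^+ (2 * j + 1))) expqx mulr1.
have -> : (c k.+2)%:R =
    (c k.+1)%:R * (q%:R ^+ (2 * j + 1) * (1 - t ^+ j.+1)) / (1 - dl * x ^+ k.+1).
  by rewrite -E' mulfK.
rewrite mulrAC -[X in X / _]mulrAC IHk hE qpochS xE.
have := qpoch_neq0 t_gt0 t_lt1 k./2; have := qpoch_neq0 t_gt0 t_lt1 j.
move: d0 j0.
move: (1 - dl * x ^+ k.+1) (1 - t ^+ j.+1) (qpoch t j) (qpoch t k./2) => a b e f.
move: (q%:R ^+ (2 * j + 1)) (x ^+ (j.+1 ^ 2)) (qpoch t n.-1) => g h p a0 b0 e0 f0.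
by field; apply/and4P.
Qed.

Lemma odd_sum_closed_form :
  (\sum_(k < n.+1 | odd k) c k)%N%:R / q%:R ^+ (n ^ 2) =
  (c 1)%:R * x ^+ (n + n).-1 * involution_sum x n.-1.
Proof.
pose m := n.-1; have nE : n = m.+1 by rewrite prednK.
have CF (i : nat) : (i <= m)%N -> (c i.+1)%:R / q%:R ^+ (m.+1 ^ 2) =
    (c 1)%:R * x ^+ (m.+1 + m.+1).-1 *
      (x ^+ ((m - i) ^ 2) * (qpoch t m / (qpoch t (m - i) * qpoch t i./2))).
  by move=> im; have := @recursion_closed_form i.+1; rewrite nE subSS; apply.
(* The term at 0 drops out as 0 is even, and reversing the order turns [k] into [j = n - k]. *)
rewrite nE big_mkcond big_ord_recl /= add0n natr_sum mulr_suml.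
rewrite /involution_sum mulr_sumr [RHS]big_mkcond (reindex_inj rev_ord_inj) /=.
apply: eq_bigr => i _; rewrite subSS /bump /= add1n.
have im : (i <= m)%N by rewrite -ltnS.
rewrite add0n; case: ifP => _; last by rewrite mul0r.
by rewrite CF ?leq_subr // subKn.
Qed.

End ClosedForm.

(** * Convergence of the infinite products *)

Local Open Scope classical_set_scope.
Local Open Scope ring_scope.

Lemma cvg_comp_geid (T : topologicalType) (u : nat -> T) (l : T) (h : nat -> nat) :
  (forall m, (m <= h m)%N) -> u @ \oo --> l -> (u \o h) @ \oo --> l.
Proof.
move=> hm ul; apply: cvg_comp ul => A [N _ NA]; exists N => // m /= Nm.
by apply: NA => /=; apply: leq_trans (hm m).
Qed.

Section OddProductLimits.
Variables (R : realType) (x : R).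
Hypotheses (x_gt0 : 0 < x) (x_le2 : x <= 2^-1).

Let x_lt1 : x < 1. Proof. by have := x_le2; lra. Qed.

Lemma odd_prod_ge0 (y : R) m : `|y| <= 1 -> 0 <= odd_prod y m.
Proof.
move=> y1; apply: prodr_ge0 => i _.
have : `|y ^+ (2 * i + 1)| <= 1 by rewrite normrX exprn_ile1.
by rewrite ler_norml => /andP[]; lra.
Qed.

Lemma odd_prod_cvg : cvgn (odd_prod x).
Proof.
apply: nondecreasing_is_cvgn.
  apply/nondecreasing_seqP => m; rewrite /odd_prod big_ord_recr /=.
  rewrite ler_peMr ?lerDl ?exprn_ge0 //; last exact: ltW.
  by apply: (@odd_prod_ge0 x m); rewrite ger0_norm ltW.
exists 3 => _ [m _ <-]; apply: le_trans (odd_prod_ub x_gt0 x_le2 m) _.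
by rewrite gerBl mulr_ge0 // exprn_ge0 // ltW.
Qed.

Lemma odd_prodN_cvg : cvgn (odd_prod (- x)).
Proof.
have N1 : `|- x| <= 1 by rewrite normrN ger0_norm ltW.
apply: nonincreasing_is_cvgn.
  apply/nonincreasing_seqP => m; rewrite /odd_prod big_ord_recr /=.
  rewrite ler_piMr ?(@odd_prod_ge0 (- x) m) // exprNn addn1 -signr_odd /= oddM /= expr1 mulN1r.
  by rewrite gerBl exprn_ge0 // ltW.
by exists 0 => _ [m _ <-]; apply: odd_prod_ge0.
Qed.

Lemma infinite_prodE (y : R) (v : nat -> R) : cvgn (odd_prod y) ->
  (forall i, v i.+1 = 1 + y ^+ (2 * i + 1)) ->
  odd_prod y @ \oo --> infinite_prod v.
Proof.
move=> cvgy vE; suff -> : infinite_prod v = limn (odd_prod y) by [].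
congr (limn _); apply/funext => N; rewrite big_add1 /= big_mkord.
by apply: eq_bigr => i _; rewrite vE.
Qed.

End OddProductLimits.

(** * Limits *)

(** Cauchy's theorem in the additive group gives a nonzero [a] with [2a = 0]; cancel [a]. *)
Lemma pchar2_even_card (F : finFieldType) : ~~ odd #|F| -> 2 \in [pchar F].
Proof.
rewrite -dvdn2 -cardsT => evF.
have [a _ oa] := Cauchy (isT : prime 2) (evF : (2 %| #|[set: F]%G|)%N).
have a2 : (a : F) *+ 2 = 0 by have := expg_order a; rewrite oa FinRing.zmodXgE.
have a0 : (a : F) != 0 by apply/eqP => a0; have := oa; rewrite a0 order1.
rewrite inE /=; apply/eqP; apply: (mulIf a0).
by rewrite mul0r mulr_natl.
Qed.

Lemma hyperbolic_polarE (F : finFieldType) n (u v : 'rV[F]_(n + n)) :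
  polar (@hyperbolic_form F n) u v =
  \sum_(i < n) (u 0 (lshift n i) * v 0 (rshift n i) + v 0 (lshift n i) * u 0 (rshift n i)).
Proof.
rewrite /polar /hyperbolic_form -!sumrB; apply: eq_bigr => i _; rewrite !mxE; ring.
Qed.

Lemma hyperbolic_quadratic (F : finFieldType) n : quadratic_form (@hyperbolic_form F n).
Proof.
split=> [a v|].
  by rewrite mulr_sumr; apply: eq_bigr => i _; rewrite !mxE; ring.
split=> [v a x y|v a x y]; rewrite /= !hyperbolic_polarE mulr_sumr -big_split /=;
  apply: eq_bigr => i _; rewrite !mxE; ring.
Qed.

Lemma hyperbolic_non_defective (F : finFieldType) n : non_defective (@hyperbolic_form F n).
Proof.
move=> u Bu; apply/rowP => k; rewrite mxE -[k]fintype.splitK; case: (fintype.split k) => i /=.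
  have := Bu (delta_mx 0 (rshift n i)); rewrite hyperbolic_polarE (bigD1 i) //= big1 => [|j ji].
    by rewrite !mxE !eqxx eq_lrshift /= mulr1 mul0r !addr0.
  by rewrite !mxE eq_lrshift eq_rshift (negPf ji) /= mulr0 mul0r addr0.
have := Bu (delta_mx 0 (lshift n i)); rewrite hyperbolic_polarE (bigD1 i) //= big1 => [|j ji].
  by rewrite !mxE !eqxx eq_rlshift /= mulr0 mul1r add0r addr0.
by rewrite !mxE eq_rlshift eq_lshift (negPf ji) /= mulr0 mul0r addr0.
Qed.

Lemma form_type_nondegenerate (F : finFieldType) n s (Q : 'rV[F]_(n + n) -> F) :
  has_form_type s Q -> quadratic_form Q /\ non_defective Q.
Proof.
case: s => /= [->|[]//].
by split; [exact: hyperbolic_quadratic | exact: hyperbolic_non_defective].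
Qed.

Section InvolutionRatio.
Variables (R : realType) (F : finFieldType) (n : nat) (Q : 'rV[F]_(n + n) -> F).
Hypotheses (F2 : 2 \in [pchar F]) (Qquad : quadratic_form Q) (Qnd : non_defective Q).
Hypothesis n_ge3 : (2 < n)%N.
Local Notation q := #|F|.
Let x : R := q%:R^-1.

Let q_gt1 : (1 < q)%N. Proof. exact: card_finNzRing_gt1. Qed.
Let q_neq0 : q%:R != 0 :> R. Proof. by rewrite pnatr_eq0 -lt0n ltnW. Qed.
Let x_gt0 : 0 < x. Proof. by rewrite invr_gt0 ltr0n ltnW. Qed.
Let x_le2 : x <= 2^-1.
Proof. by rewrite lef_pV2 ?posrE ?ltr0n ?ler_nat // ltnW. Qed.
Let x_ge0 : 0 <= x. Proof. exact: ltW. Qed.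
Let x_le1 : x <= 1. Proof. by have := x_le2; lra. Qed.

(** This is [card_quad_fiber1] after normalization: the deviation [q^(n-1)] divided by [q^(2n-1)] is
    [x^n]. *)
Lemma nonsingular_ratio :
  `|#|quad_fiber Q 1%R|%:R * x ^+ (n + n).-1 - 1| = x ^+ n.
Proof.
have d0 : (0 < n + n)%N by rewrite addn_gt0; move: n_ge3; lia.
have := card_quad_fiber1 F2 Qquad Qnd d0 => /(congr1 (fun z : int => z%:~R : R)).
rewrite rmorphM rmorphXn rmorphB /= -!pmulrn natrX.
set N := #|quad_fiber Q 1%R|%:R => E.
have qx m : q%:R ^+ m * x ^+ m = 1 by rewrite -exprMn divff ?expr1n.
apply/eqP; rewrite -(@eqrXn2 _ 2) ?normr_ge0 ?exprn_ge0 // real_normK ?num_real //.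
have -> : N * x ^+ (n + n).-1 - 1 = (N - q%:R ^+ (n + n).-1) * x ^+ (n + n).-1.
  by rewrite mulrBl qx.
apply/eqP; apply: (mulIf q_neq0); rewrite exprMn mulrAC E expr2 mulrA qx mul1r.
rewrite -exprM -[in RHS](_ : (n + n).-1.+1 = n * 2)%N; last by rewrite muln2 -addnn prednK.
by rewrite exprSr -mulrA mulVf ?mulr1.
Qed.

Lemma involution_ratio_bound :
  `|(num_involutions (isometry_group Q :\: Omega Q))%:R / q%:R ^+ (n ^ 2)
    - parity_sum x n.-1| <= 5 * (5 / 8) ^+ n.-1 :> R.
Proof.
rewrite (num_involutions_sum F2 Qquad Qnd); last by move: n_ge3; lia.
have -> : (n + n)./2 = n by rewrite addnn doubleK.
have c_rec k : (0 < k < n)%N ->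
    (#|nonalternating_rank Q k.+1| * (q ^ k - ~~ odd k) =
     #|nonalternating_rank Q k| * (q ^ (n + n - k).-1 - q ^ k.-1))%N.
  by move=> /andP[k0 _]; exact: nonalternating_rankS.
rewrite (odd_sum_closed_form R q_gt1 _ c_rec); last by move: n_ge3; lia.
rewrite nonalternating_rank1 // -/x; have uE := nonsingular_ratio.
have /andP[lo hi] := involution_sum_bounds x_gt0 x_le2 n.-1.
have err := prod_error_bound x_gt0 x_le2 n.-1.
have par3 : parity_sum x n.-1 <= 3.
  apply: le_trans (_ : odd_prod x n.-1 <= _).
    rewrite (odd_prod_sum x_gt0 x_le2 _ erefl) /parity_sum big_mkcond; apply: ler_sum => j _.
    case: ifP => // _; rewrite mulr_ge0 ?exprn_ge0 // qbinom_ge0 ?exprn_gt0 //.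
    by rewrite exprn_ilt1 //; have := x_le2; lra.
  apply: le_trans (odd_prod_ub x_gt0 x_le2 _) _.
  by rewrite gerBl mulr_ge0 // exprn_ge0.
have inv0 : 0 <= involution_sum x n.-1.
  apply: sumr_ge0 => j _; rewrite mulr_ge0 ?exprn_ge0 // divr_ge0 ?mulr_ge0 //;
    apply: ltW; apply: qpoch_gt0; rewrite ?exprn_gt0 // exprn_ilt1 //;
    by have := x_le2; lra.
have xn : x ^+ n <= (5 / 8) ^+ n.-1.
  apply: le_trans (_ : x ^+ n.-1 <= _); first by rewrite ler_wiXn2l // leq_pred.
  by apply: lerXn2r; rewrite ?nnegrE //; have := x_le2; lra.
move: uE lo hi err par3 inv0 xn.
move: (_ * x ^+ (n + n).-1) (involution_sum _ _) (parity_sum _ _) (x ^+ n) ((5 / 8) ^+ n.-1)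
  (x ^+ n.-1 * _) => u A E e g b uE lo hi err E3 A0 eg.
(* The first summand is at most [3 g], as [A <= E <= 3], and the second at most [2 g], whence the
   constant 5. *)
have -> : u * A - E = (u - 1) * A + (A - E) by ring.
apply: le_trans (ler_normD _ _) _; rewrite normrM uE (ger0_norm A0).
have -> : `|A - E| = E - A by rewrite ler0_norm ?opprB // subr_le0.
have e0 : 0 <= e by rewrite -uE.
have : e * A <= g * 3 by apply: ler_pM => //; apply: le_trans E3.
lra.
Qed.

End InvolutionRatio.

Theorem theorem7p7 (R : realType) (F : finFieldType) (q : nat)
    (card_F : #|F| = q) (q_even : ~~ odd q) (s : form_type)
    (Q : forall n : nat, 'rV[F]_(n + n) -> F)
    (Q_type : forall n : nat, (0 < n)%N -> has_form_type s (Q n)) :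
  ((fun m : nat =>
      (num_involutions (isometry_group (Q (2 * m)%N)
                          :\: Omega (Q (2 * m)%N)))%:R
        / q%:R ^+ ((2 * m) ^ 2)%N : R) @ \oo -->
     2^-1 * (infinite_prod (fun i : nat => 1 + 1 / q%:R ^+ (2 * i - 1)%N : R)
             - infinite_prod (fun i : nat => 1 - 1 / q%:R ^+ (2 * i - 1)%N : R)))
  /\
  ((fun m : nat =>
      (num_involutions (isometry_group (Q (2 * m + 1)%N)
                          :\: Omega (Q (2 * m + 1)%N)))%:R
        / q%:R ^+ ((2 * m + 1) ^ 2)%N : R) @ \oo -->
     2^-1 * (infinite_prod (fun i : nat => 1 + 1 / q%:R ^+ (2 * i - 1)%N : R)
             + infinite_prod (fun i : nat => 1 - 1 / q%:R ^+ (2 * i - 1)%N : R))).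
Proof.
have F2 : 2 \in [pchar F] by apply: pchar2_even_card; rewrite card_F.
pose x : R := q%:R^-1.
have q1 : (1 < q)%N by rewrite -card_F; exact: card_finNzRing_gt1.
have x0 : 0 < x by rewrite invr_gt0 ltr0n ltnW.
have x2 : x <= 2^-1 by rewrite lef_pV2 ?posrE ?ltr0n ?ler_nat // ltnW.
pose f n : R := (num_involutions (isometry_group (Q n) :\: Omega (Q n)))%:R
  / q%:R ^+ (n ^ 2).
(* The shift by 3 guarantees dimension greater than 4 at every index. *)
have fE : (fun n => f n.+3 - parity_sum x n.+2) @ \oo --> (0 : R).
  apply/norm_cvg0P; apply: (@squeeze_cvgr _ _ _ _ (cst 0) (fun n => 5 * (5 / 8) ^+ n : R)).
  - near=> n; rewrite normr_ge0 /=.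
    have [Qq Qn] := form_type_nondegenerate (Q_type n.+3 isT).
    have := involution_ratio_bound R F2 Qq Qn isT.
    rewrite /f /x -card_F /= => /le_trans; apply.
    by rewrite ler_wpM2l // ler_wiXn2l ?(leq_trans _ (leq_addl 2 n)) //; lra.
  - exact: cvg_cst.
  - by apply: cvg_geometric; rewrite ger0_norm; lra.
have prodP : odd_prod x @ \oo -->
    infinite_prod (fun i : nat => 1 + 1 / q%:R ^+ (2 * i - 1)%N : R).
  apply: infinite_prodE; first exact: odd_prod_cvg.
  move=> i; rewrite div1r -exprVn; congr (1 + _ ^+ _); lia.
have prodN : odd_prod (- x) @ \oo -->
    infinite_prod (fun i : nat => 1 - 1 / q%:R ^+ (2 * i - 1)%N : R).
  apply: infinite_prodE; first exact: odd_prodN_cvg.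
  move=> i; rewrite div1r -exprVn exprNn -signr_odd addn1 /= oddM /= expr1 mulN1r.
  by congr (1 - _ ^+ _); lia.
(* For forms of rank [2n] with [n = (h m).+3], the sign [(-1)^(n-1)] in [parity_sumE] depends only
   on the parity [b] of [h m]. *)
have lim (h : nat -> nat) (b : bool) (l : R) :
    (forall m, (m <= h m)%N) -> (forall m, odd (h m) = b) ->
    2^-1 * (infinite_prod (fun i : nat => 1 + 1 / q%:R ^+ (2 * i - 1)%N : R)
             + (-1) ^+ b * infinite_prod (fun i : nat => 1 - 1 / q%:R ^+ (2 * i - 1)%N : R)) = l ->
    (fun m => f (h m).+3) @ \oo --> l.
  move=> hm hb <-.
  have -> : (fun m => f (h m).+3) = (fun n => f n.+3 - parity_sum x n.+2) \o h
      \+ (fun m => 2^-1 * (odd_prod x (h m).+2 + (-1) ^+ b * odd_prod (- x) (h m).+2)).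
    apply/funext => m /=; rewrite parity_sumE // -[in (-1) ^+ (h m).+2]signr_odd /= negbK hb.
    by rewrite subrK.
  rewrite -[X in _ --> X]add0r; apply: cvgD; first exact: cvg_comp_geid.
  have hm2 m : (m <= (h m).+2)%N by rewrite (leq_trans (hm m)) // -addn2 leq_addr.
  apply: cvgMr; apply: cvgD; first exact: (cvg_comp_geid hm2 prodP).
  by apply: cvgMr; exact: (cvg_comp_geid hm2 prodN).
split.
  rewrite -[X in X @ \oo --> _]/(fun m => f (2 * m)%N) -(cvg_shiftn 2).
  (* Dropping two terms writes the even index as [(2 * m + 1).+3], of odd [h], so the products are
     subtracted. *)
  have -> : [sequence f (2 * (m + 2))%N]_m = (fun m => f (2 * m + 1).+3).
    by apply/funext => m; congr f; lia.
  apply: (lim _ true); [by move=> m; lia | by move=> m; lia |].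
  by rewrite expr1 mulN1r.
rewrite -[X in X @ \oo --> _]/(fun m => f (2 * m + 1)%N) -(cvg_shiftn 1).
have -> : [sequence f (2 * (m + 1) + 1)%N]_m = (fun m => f (2 * m).+3).
  by apply/funext => m; congr f; lia.
apply: (lim _ false); [by move=> m; lia | by move=> m; lia |].
by rewrite expr0 mul1r.
Unshelve. all: by end_near.
Qed.
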